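(* Let $u,f\in\mathcal{D}'(\mathbb{R}^n)$ and let $f^\nu\in C^\infty(\mathbb{R}^n)$, $\nu\in\mathbb{N}$, fulfil $\lim_{\nu\to\infty}f^\nu=f$ in $\mathcal{D}'(\mathbb{R}^n)$ and in $C^\infty(\mathbb{R}^n\setminus F)$ for $F=\operatorname{sing\,supp}f$. When $\operatorname{sing\,supp}u\cap\operatorname{sing\,supp}f=\emptyset$, then $$f^\nu u\to fu\quad\text{in }\mathcal{D}'(\mathbb{R}^n)\text{ for }\nu\to\infty.$$ If moreover $\operatorname{supp}u\cap\operatorname{supp}f$ is compact and $\chi\in C^\infty_0(\mathbb{R}^n)$ equals $1$ around this set, then $$\lim_{\nu\to\infty}\langle\chi u,f^\nu\rangle=\lim_{\nu\to\infty}\langle u,\chi f^\nu\rangle=\langle u,f\rangle.$$ Here one can take $\chi\equiv1$ on $\mathbb{R}^n$ if a compact set contains $\operatorname{supp}u$ or $\bigcup_\nu\operatorname{supp}(f^\nu u)$. The conclusions hold verbatim when, instead of $F=\operatorname{sing\,supp}f$, $F\subset\mathbb{R}^n$ is any closed set with $\operatorname{sing\,supp}f\subset F\subset(\mathbb{R}^n\setminus\operatorname{sing\,supp}u)$.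
   Context: If $f,u\in\mathcal{D}'(\mathbb{R}^n)$ have $\operatorname{sing\,supp}f\cap\operatorname{sing\,supp}u=\emptyset$, the product $fu\in\mathcal{D}'(\mathbb{R}^n)$ is the unique distribution which on $\mathbb{R}^n\setminus\operatorname{sing\,supp}u$ equals the product of the distribution $f$ by the smooth function $u$, and on $\mathbb{R}^n\setminus\operatorname{sing\,supp}f$ equals the product of the distribution $u$ by the smooth function $f$. If moreover $\operatorname{supp}u\cap\operatorname{supp}f$ is compact, the (bilinear) extended action is $\langle u,f\rangle:=\langle fu,1\rangle=\langle fu,\varphi\rangle$ for any $\varphi\in C^\infty_0(\mathbb{R}^n)$ equal to $1$ around $\operatorname{supp}(fu)$. Convergence in $C^\infty(\Omega)$ means uniform convergence of all derivatives on compact subsets of the open set $\Omega$ (with $f$ identified with a smooth function on $\Omega\subset\mathbb{R}^n\setminus\operatorname{sing\,supp}f$). *)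

(* Defs.v *)
From HB Require Import structures.
From mathcomp Require Import all_boot all_order all_algebra.
From mathcomp Require Import all_classical all_reals all_analysis.
From mathcomp Require Import complex.

Set Implicit Arguments.
Unset Strict Implicit.
Unset Printing Implicit Defensive.
Import Order.TTheory GRing.Theory Num.Theory.
Import numFieldNormedType.Exports.
Local Open Scope classical_set_scope.
Local Open Scope ring_scope.

(* Bundling R[i] at numClosedFieldType gives it the topology of its norm. *)
Definition Cplx (R : realType) : numClosedFieldType := R[i].

Definition modulus (R : realType) (z : Cplx R) : R := complex.Re `|z|.

Definition partial (R : realType) (n : nat) (i : 'I_n)
    (g : 'rV[R]_n -> Cplx R) : 'rV[R]_n -> Cplx R :=
  fun x => Complex ('D_(delta_mx 0 i) (fun y => complex.Re (g y)) x)
                   ('D_(delta_mx 0 i) (fun y => complex.Im (g y)) x).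

(* Derivatives of order k are indexed by words of k coordinate directions;
   every multi-index occurs, possibly through several words. *)
Definition iter_partial (R : realType) (n : nat) (s : seq 'I_n)
    (g : 'rV[R]_n -> Cplx R) : 'rV[R]_n -> Cplx R :=
  foldr (@partial R n) g s.

Definition smooth_on (R : realType) (n : nat) (Om : set 'rV[R]_n)
    (g : 'rV[R]_n -> Cplx R) : Prop :=
  forall (s : seq 'I_n) (x : 'rV[R]_n), Om x ->
    {for x, continuous (iter_partial s g)} /\
    forall i : 'I_n,
      derivable (fun y => complex.Re (iter_partial s g y)) x (delta_mx 0 i) /\
      derivable (fun y => complex.Im (iter_partial s g y)) x (delta_mx 0 i).

Definition fsupp (R : realType) (n : nat) (g : 'rV[R]_n -> Cplx R) :
    set 'rV[R]_n :=
  closure [set x | g x != 0].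

(* C_0^oo(Om), its elements being extended by 0 to R^n. *)
Definition test_on (R : realType) (n : nat) (Om : set 'rV[R]_n)
    (phi : 'rV[R]_n -> Cplx R) : Prop :=
  [/\ smooth_on setT phi, compact (fsupp phi) & fsupp phi `<=` Om].

Definition one_around (R : realType) (n : nat) (A : set 'rV[R]_n)
    (chi : 'rV[R]_n -> Cplx R) : Prop :=
  forall x, A x -> \forall y \near x, chi y = 1.

(* The library has no Lebesgue measure on 'rV[R]_n, so integrals over R^n are
   iterated Lebesgue integrals; they are only ever used for integrands in
   C_0^oo(R^n), where Fubini identifies the two. *)
Fixpoint iter_integral (R : realType) (n : nat) : ('rV[R]_n -> R) -> R :=
  match n return ('rV[R]_n -> R) -> R with
  | 0 => fun f => f 0
  | m.+1 => fun f =>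
      Rintegral lebesgue_measure setT (fun t : R =>
        iter_integral (fun y : 'rV[R]_m => f (row_mx (t%:M : 'rV[R]_1) y)))
  end.

Definition cintegral (R : realType) (n : nat) (g : 'rV[R]_n -> Cplx R) :
    Cplx R :=
  Complex (iter_integral (fun x => complex.Re (g x)))
          (iter_integral (fun x => complex.Im (g x))).

(* Functionals are defined on all functions, but only their values on
   C_0^oo(R^n) are ever constrained or used. *)
Definition functional (R : realType) (n : nat) : Type :=
  ('rV[R]_n -> Cplx R) -> Cplx R.

Definition is_distribution (R : realType) (n : nat) (u : functional R n) : Prop :=
  (forall (a : Cplx R) (phi psi : 'rV[R]_n -> Cplx R),
     test_on setT phi -> test_on setT psi ->
     u (fun x => a * phi x + psi x) = a * u phi + u psi) /\
  (forall K : set 'rV[R]_n, compact K ->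
     exists (c : R) (N : nat), forall phi : 'rV[R]_n -> Cplx R,
       test_on setT phi -> fsupp phi `<=` K ->
       modulus (u phi) <=
         c * \sum_(k < N.+1) \sum_(s : k.-tuple 'I_n)
               sup (range (fun x => modulus (iter_partial s phi x)))).

Definition cvg_distr (R : realType) (n : nat) (w : nat -> functional R n)
    (w0 : functional R n) : Prop :=
  forall phi, test_on setT phi -> (fun nu => w nu phi) @ \oo --> w0 phi.

(* The distribution identified with a function g. *)
Definition distr_of (R : realType) (n : nat) (g : 'rV[R]_n -> Cplx R) :
    functional R n :=
  fun phi => cintegral (fun x => g x * phi x).

(* The product of a distribution by a smooth function. When g is smooth on
   Om only, g phi still lies in C_0^oo(Om) for phi in C_0^oo(Om), whatever
   the values of g off Om. *)
Definition smul (R : realType) (n : nat) (g : 'rV[R]_n -> Cplx R)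
    (u : functional R n) : functional R n :=
  fun phi => u (fun x => g x * phi x).

Definition eq_distr_on (R : realType) (n : nat) (Om : set 'rV[R]_n)
    (u v : functional R n) : Prop :=
  forall phi, test_on Om phi -> u phi = v phi.

Definition smooth_rep (R : realType) (n : nat) (Om : set 'rV[R]_n)
    (u : functional R n) (g : 'rV[R]_n -> Cplx R) : Prop :=
  smooth_on Om g /\ eq_distr_on Om u (distr_of g).

Definition dsupp (R : realType) (n : nat) (u : functional R n) :
    set 'rV[R]_n :=
  ~` [set x | exists U : set 'rV[R]_n,
        [/\ open U, U x & eq_distr_on U u (fun=> 0)]].

Definition sing_supp (R : realType) (n : nat) (u : functional R n) :
    set 'rV[R]_n :=
  ~` [set x | exists U : set 'rV[R]_n,
        [/\ open U, U x & exists g, smooth_rep U u g]].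

(* f^nu -> f in C^oo(Om), for f equal to a smooth function on Om. *)
Definition cvg_smooth (R : realType) (n : nat) (Om : set 'rV[R]_n)
    (fs : nat -> 'rV[R]_n -> Cplx R) (f : functional R n) : Prop :=
  exists2 g, smooth_rep Om f g &
    forall (s : seq 'I_n) (K : set 'rV[R]_n), compact K -> K `<=` Om ->
      {uniform K, (fun nu => iter_partial s (fs nu)) @ \oo
                    --> iter_partial s g}.

Definition is_dprod (R : realType) (n : nat) (f u w : functional R n) : Prop :=
  [/\ is_distribution w,
      exists2 g, smooth_rep (~` sing_supp u) u g &
        eq_distr_on (~` sing_supp u) w (smul g f) &
      exists2 h, smooth_rep (~` sing_supp f) f h &
        eq_distr_on (~` sing_supp f) w (smul h u)].

(* The product f u; when the singular supports are disjoint, is_dprod f u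
   determines it on C_0^oo(R^n). *)
Definition dprod (R : realType) (n : nat) (f u : functional R n) :
    functional R n :=
  xget (fun=> 0) [set w | is_dprod f u w].

(* <w, 1> for w of compact support; the value does not depend on the choice of
   the cut-off function. *)
Definition pair_one (R : realType) (n : nat) (w : functional R n) : Cplx R :=
  w (xget (fun=> 0) [set phi | test_on setT phi /\ one_around (dsupp w) phi]).

(* <u, f> := <f u, 1> *)
Definition ext_action (R : realType) (n : nat) (u f : functional R n) :
    Cplx R :=
  pair_one (dprod f u).

(* Main.v *)
Require Import Defs.
From mathcomp Require Import all_boot all_order all_algebra.
From mathcomp Require Import all_classical all_reals all_analysis.
From mathcomp Require Import complex ring lra.
Import Order.TTheory GRing.Theory Num.Theory.
Import numFieldNormedType.Exports.
Local Open Scope classical_set_scope.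
Local Open Scope ring_scope.

Set Implicit Arguments.
Unset Strict Implicit.
Unset Printing Implicit Defensive.

(** Near a point where u is a smooth function g, the product f^nu u acts on a test
    function phi as f^nu acts on g phi, so there it converges because f^nu -> f in
    the sense of distributions. Near a point outside F, the functions f^nu phi
    converge to f phi with all derivatives, uniformly, so there f^nu u converges by
    the continuity of u. As F does not meet the singular support of u, the two
    kinds of points cover the space, and a partition of unity ([test_ind]) gives
    the convergence of f^nu u on every test function.

    The limit w is a distribution with the two defining properties of the product
    f u ([is_dprod_lim]), and these determine it ([is_dprod_unique]), again because
    they can be checked locally. So [dprod f u] is w, and the first claim follows.
    Representatives on the full complements of the singular supports come from
    gluing local ones ([exists_smooth_rep]), which agree on overlaps by the
    fundamental lemma of the calculus of variations ([smooth_rep_unique]); this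
    lemma rests on the linearity and strict positivity of iterated integrals.

    For the extended actions, <w, 1> equals w phi for every test function phi equal
    to 1 around the support of w ([pair_eval]). The support of f u lies in that of
    u and in that of f, and the supports of chi f^nu u lie in a fixed compact set,
    so one phi serves for all nu. Both actions then equal the action of f^nu u on
    chi phi, whose limit is <f u, chi phi> = <u, f> as chi phi is 1 around the
    support of f u ([cvg_ext_action]).

    The cut-offs are built from exp(-1/t), with composition in place of quotients
    ([exists_plateau]). *)

(** * The complex modulus *)

Local Notation Re := complex.Re.
Local Notation Im := complex.Im.

Section Modulus.
Context {R : realType}.
Implicit Types z w : Cplx R.

Lemma cplx_eqP z w : Re z = Re w -> Im z = Im w -> z = w.
Proof. by case: z w => a b [c d] /= -> ->. Qed.

Lemma ReD z w : Re (z + w) = Re z + Re w. Proof. by case: z w => a b []. Qed.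
Lemma ImD z w : Im (z + w) = Im z + Im w. Proof. by case: z w => a b []. Qed.
Lemma ReB z w : Re (z - w) = Re z - Re w. Proof. by case: z w => a b []. Qed.
Lemma ImB z w : Im (z - w) = Im z - Im w. Proof. by case: z w => a b []. Qed.
Lemma ReM z w : Re (z * w) = Re z * Re w - Im z * Im w.
Proof. by case: z w => a b []. Qed.
Lemma ImM z w : Im (z * w) = Re z * Im w + Im z * Re w.
Proof. by case: z w => a b []. Qed.

Lemma normE z : `|z| = Complex (modulus z) 0.
Proof. by case: z. Qed.

Lemma modulusE z : modulus z = Num.sqrt (Re z ^+ 2 + Im z ^+ 2).
Proof. by case: z. Qed.

Lemma modulus_ge0 z : 0 <= modulus z.
Proof. by rewrite modulusE sqrtr_ge0. Qed.

Lemma modulus0 : modulus (0 : Cplx R) = 0.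
Proof. by rewrite /modulus normr0. Qed.

Lemma modulusM z w : modulus (z * w) = modulus z * modulus w.
Proof. by rewrite /modulus normrM !normE ReM /= mulr0 subr0. Qed.

Lemma modulusN z : modulus (- z) = modulus z.
Proof. by rewrite /modulus normrN. Qed.

Lemma modulusD z w : modulus (z + w) <= modulus z + modulus w.
Proof.
have := ler_normD z w; rewrite !normE => /[!lecE] /=.
by case/andP.
Qed.

Lemma modulus_sum I (r : seq I) (G : I -> Cplx R) :
  modulus (\sum_(i <- r) G i) <= \sum_(i <- r) modulus (G i).
Proof.
elim: r => [|i r ih]; first by rewrite !big_nil modulus0.
rewrite !big_cons; apply: le_trans (modulusD _ _) _; exact: lerD.
Qed.

Lemma normRe_le z : `|Re z| <= modulus z.
Proof. by rewrite modulusE -sqrtr_sqr ler_sqrt ?lerDl ?addr_ge0 ?sqr_ge0. Qed.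

Lemma normIm_le z : `|Im z| <= modulus z.
Proof. by rewrite modulusE -sqrtr_sqr ler_sqrt ?lerDr ?addr_ge0 ?sqr_ge0. Qed.

Lemma modulus_le z : modulus z <= `|Re z| + `|Im z|.
Proof.
rewrite modulusE -[leRHS](ger0_norm (addr_ge0 _ _))// -[leRHS]sqrtr_sqr.
rewrite ler_sqrt ?sqr_ge0// sqrrD !real_normK ?num_real//.
by rewrite -addrA [X in _ <= _ + X]addrC addrA lerDl mulrn_wge0 ?mulr_ge0.
Qed.

Lemma cplx_gt0 (e : Cplx R) : 0 < e -> exists2 d : R, 0 < d & e = Complex d 0.
Proof. by case: e => a b; rewrite ltcE /= => /andP[/eqP -> a0]; exists a. Qed.

Lemma ltc_norm z (x : R) : (`|z| < Complex x 0 :> Cplx R) = (modulus z < x).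
Proof. by rewrite normE ltcE /= eqxx. Qed.

(** The epsilons of the norm topology are themselves complex numbers; real ones
    suffice, because a positive complex number is real. *)
Lemma cvg_modulusP (T : Type) (F : set_system T) (FF : Filter F)
    (g : T -> Cplx R) (l : Cplx R) :
  g @ F --> l <-> forall e : R, 0 < e -> \forall x \near F, modulus (g x - l) < e.
Proof.
split=> [/cvgrPdist_lt gl e e0|gl].
  have /gl : 0 < Complex e 0 :> Cplx R by rewrite ltcE /= eqxx.
  by apply: filterS => x; rewrite ltc_norm -opprB modulusN.
apply/cvgrPdist_lt => e /cplx_gt0[d d0 ->].
by apply: filterS (gl d d0) => x; rewrite ltc_norm -opprB modulusN.
Qed.

Lemma cvg_ReIm (T : Type) (F : set_system T) (FF : Filter F)
    (g : T -> Cplx R) (l : Cplx R) :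
  g @ F --> l <->
  ((fun t => Re (g t)) @ F --> Re l) /\ ((fun t => Im (g t)) @ F --> Im l).
Proof.
split=> [/cvg_modulusP gl|[/cvgrPdist_lt gr /cvgrPdist_lt gi]].
  by split; apply/cvgrPdist_lt => e /gl; apply: filterS => x; apply: le_lt_trans;
    rewrite distrC -?ReB -?ImB ?normRe_le ?normIm_le.
apply/cvg_modulusP => e e0.
have e20 : 0 < e / 2 by rewrite divr_gt0.
near=> x.
apply: le_lt_trans (modulus_le _) _; rewrite ReB ImB [e]splitr ltrD// distrC;
near: x; [exact: gr|exact: gi].
Unshelve. all: by end_near.
Qed.

End Modulus.

(** * Smooth functions *)

Section PointwiseDerivation.
Context {R : realType} {V : normedModType R}.
Implicit Types (f g : V -> R) (x v : V).

Lemma derivable_add f g x v : derivable f x v -> derivable g x v ->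
  derivable (fun y => f y + g y) x v.
Proof. exact: derivableD. Qed.

Lemma derivable_sub f g x v : derivable f x v -> derivable g x v ->
  derivable (fun y => f y - g y) x v.
Proof. exact: derivableB. Qed.

Lemma derivable_mul f g x v : derivable f x v -> derivable g x v ->
  derivable (fun y => f y * g y) x v.
Proof. exact: derivableM. Qed.

Lemma derive_add f g x v : derivable f x v -> derivable g x v ->
  'D_v (fun y => f y + g y) x = 'D_v f x + 'D_v g x.
Proof. exact: deriveD. Qed.

Lemma derive_sub f g x v : derivable f x v -> derivable g x v ->
  'D_v (fun y => f y - g y) x = 'D_v f x - 'D_v g x.
Proof. exact: deriveB. Qed.

Lemma derive_mul f g x v : derivable f x v -> derivable g x v ->
  'D_v (fun y => f y * g y) x = f x * 'D_v g x + g x * 'D_v f x.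
Proof. exact: deriveM. Qed.

End PointwiseDerivation.

Section Smooth.
Context {R : realType} {n : nat}.
Local Notation V := 'rV[R]_n.
Implicit Types (g h : V -> Cplx R) (Om : set V) (i : 'I_n) (s : seq 'I_n) (x : V).

(** One-constructor inductives rather than definitions: unification then compares
    functions and points instead of unfolding the limits behind them. *)
Variant cderivable i g x : Prop :=
  CDerivable of derivable (fun y => Re (g y)) x (delta_mx 0 i)
              & derivable (fun y => Im (g y)) x (delta_mx 0 i).

Variant ccontinuous g x : Prop := CContinuous of {for x, continuous g}.

Lemma near_cderivable i g h x :
  (\forall y \near x, g y = h y) -> cderivable i g x -> cderivable i h x.
Proof.
move=> gh [gr gi]; split; [apply: near_eq_derivable gr|apply: near_eq_derivable gi];
  by apply: filterS gh => y ->.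
Qed.

Lemma near_partial i g h x :
  (\forall y \near x, g y = h y) -> partial i g x = partial i h x.
Proof.
by move=> gh; apply: cplx_eqP => /=; apply: near_eq_derive;
  apply: filterS gh => y ->.
Qed.

Lemma near_ccontinuous g h x : (\forall y \near x, g y = h y) ->
  ccontinuous g x -> ccontinuous h x.
Proof.
move=> gh [gc]; split; move: gc.
rewrite /prop_for /continuous_at -(nbhs_singleton gh).
exact: (cvg_trans (near_eq_cvg gh)).
Qed.

Lemma ccontinuous_cst (c : Cplx R) x : ccontinuous (fun=> c) x.
Proof. by split; exact: cst_continuous. Qed.

Lemma ccontinuousD g h x : ccontinuous g x -> ccontinuous h x ->
  ccontinuous (fun y => g y + h y) x.
Proof. move=> [gc] [hc]; split; exact: (cvgD gc hc). Qed.

Lemma ccontinuousM g h x : ccontinuous g x -> ccontinuous h x ->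
  ccontinuous (fun y => g y * h y) x.
Proof. move=> [gc] [hc]; split; exact: (cvgM gc hc). Qed.

Lemma cderivable_cst i (c : Cplx R) x : cderivable i (fun=> c) x.
Proof. by split; exact: derivable_cst. Qed.

Lemma partial_cst i (c : Cplx R) : partial i (fun=> c) = fun=> 0.
Proof.
by apply/funext => x; apply: cplx_eqP => /=; rewrite derive_cst.
Qed.

Lemma ReD_fun g h : (fun y => Re (g y + h y)) = (fun y => Re (g y) + Re (h y)).
Proof. by apply/funext => y; rewrite ReD. Qed.

Lemma ImD_fun g h : (fun y => Im (g y + h y)) = (fun y => Im (g y) + Im (h y)).
Proof. by apply/funext => y; rewrite ImD. Qed.

Lemma ReM_fun g h : (fun y => Re (g y * h y)) =
  (fun y => Re (g y) * Re (h y) - Im (g y) * Im (h y)).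
Proof. by apply/funext => y; rewrite ReM. Qed.

Lemma ImM_fun g h : (fun y => Im (g y * h y)) =
  (fun y => Re (g y) * Im (h y) + Im (g y) * Re (h y)).
Proof. by apply/funext => y; rewrite ImM. Qed.

Lemma cderivableD i g h x : cderivable i g x -> cderivable i h x ->
  cderivable i (fun y => g y + h y) x.
Proof.
move=> [gr gi] [hr hi].
split; rewrite ?ReD_fun ?ImD_fun; [exact: (derivable_add gr hr)|exact: (derivable_add gi hi)].
Qed.

Lemma partialD i g h x : cderivable i g x -> cderivable i h x ->
  partial i (fun y => g y + h y) x = partial i g x + partial i h x.
Proof.
move=> [gr gi] [hr hi]; apply: cplx_eqP; rewrite ?ReD ?ImD /= ?ReD_fun ?ImD_fun.
  exact: (derive_add gr hr).
exact: (derive_add gi hi).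
Qed.

Lemma cderivableM i g h x : cderivable i g x -> cderivable i h x ->
  cderivable i (fun y => g y * h y) x.
Proof.
move=> [gr gi] [hr hi]; split; rewrite ?ReM_fun ?ImM_fun.
  exact: (derivable_sub (derivable_mul gr hr) (derivable_mul gi hi)).
exact: (derivable_add (derivable_mul gr hi) (derivable_mul gi hr)).
Qed.

Lemma partialM i g h x : cderivable i g x -> cderivable i h x ->
  partial i (fun y => g y * h y) x = partial i g x * h x + g x * partial i h x.
Proof.
move=> [gr gi] [hr hi]; apply: cplx_eqP.
  rewrite ReD !ReM /= ReM_fun.
  rewrite (derive_sub (derivable_mul gr hr) (derivable_mul gi hi)).
  rewrite (derive_mul gr hr) (derive_mul gi hi); ring.
rewrite ImD !ImM /= ImM_fun.
rewrite (derive_add (derivable_mul gr hi) (derivable_mul gi hr)).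
rewrite (derive_mul gr hi) (derive_mul gi hr); ring.
Qed.

(** Recursion on the order, unlike the words of [smooth_on], fits the product and
    chain rules: the partial derivatives of a product or of a composite are sums
    of products of functions of the same kind, of one order less. *)
Fixpoint Ck (k : nat) Om g : Prop :=
  (forall x, Om x -> ccontinuous g x) /\
  if k is k'.+1 then
    forall i, (forall x, Om x -> cderivable i g x) /\ Ck k' Om (partial i g)
  else True.

Lemma CkW k Om g : Ck k.+1 Om g -> Ck k Om g.
Proof.
elim: k g => [|k ih] g; first by case.
move=> [gc gd]; split=> // i; have [gi gp] := gd i; split=> //.
exact: ih.
Qed.

Lemma Ck_eq k Om g h : open Om -> (forall x, Om x -> g x = h x) ->
  Ck k Om g -> Ck k Om h.
Proof.
move=> oO.
have near_O g1 g2 x : Om x -> (forall x, Om x -> g1 x = g2 x) -> \forall y \near x, g1 y = g2 y.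
  move=> Ox eqg; exact: filterS (open_nbhs_nbhs (conj oO Ox)).
elim: k g h => [|k ih] g h gh [gc gd]; split=> //.
- by move=> x Ox; apply: near_ccontinuous (gc x Ox); exact: near_O.
- by move=> x Ox; apply: near_ccontinuous (gc x Ox); exact: near_O.
- move=> i; have [gdi gp] := gd i; split.
    by move=> x Ox; apply: near_cderivable (gdi x Ox); exact: near_O.
  by apply: ih gp => x Ox; apply: near_partial; exact: near_O.
Qed.

Lemma Ck_cst k Om (c : Cplx R) : Ck k Om (fun=> c).
Proof.
elim: k c => [|k ih] c; split=> //; try by move=> x _; exact: ccontinuous_cst.
move=> i; split; first by move=> x _; exact: cderivable_cst.
by rewrite partial_cst.
Qed.

Lemma CkD k Om g h : open Om -> Ck k Om g -> Ck k Om h ->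
  Ck k Om (fun x => g x + h x).
Proof.
move=> oO; elim: k g h => [|k ih] g h [gc gd] [hc hd].
  by split=> // x Ox; apply: ccontinuousD; [exact: gc|exact: hc].
split; first by move=> x Ox; apply: ccontinuousD; [exact: gc|exact: hc].
move=> i; have [gi gp] := gd i; have [hi hp] := hd i; split.
  by move=> x Ox; apply: cderivableD; [exact: gi|exact: hi].
apply: Ck_eq (ih _ _ gp hp) => // x Ox.
by rewrite partialD//; [exact: gi|exact: hi].
Qed.

Lemma CkM k Om g h : open Om -> Ck k Om g -> Ck k Om h ->
  Ck k Om (fun x => g x * h x).
Proof.
move=> oO; elim: k g h => [|k ih] g h.
  move=> [gc _] [hc _]; split=> // x Ox.
  by apply: ccontinuousM; [exact: gc|exact: hc].
move=> gk hk; have [[gc gd] [hc hd]] := (gk, hk).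
split; first by move=> x Ox; apply: ccontinuousM; [exact: gc|exact: hc].
move=> i; have [gi gp] := gd i; have [hi hp] := hd i; split.
  by move=> x Ox; apply: cderivableM; [exact: gi|exact: hi].
apply: (@Ck_eq _ _ (fun x => partial i g x * h x + g x * partial i h x)) => //.
  by move=> x Ox; rewrite partialM//; [exact: gi|exact: hi].
by apply: CkD => //; apply: ih => //; exact: CkW.
Qed.

Variant smooth Om g : Prop := Smooth of forall k, Ck k Om g.

Lemma iter_partial_rcons s i g :
  iter_partial (rcons s i) g = iter_partial s (partial i g).
Proof. by rewrite /iter_partial foldr_rcons. Qed.

Lemma smooth_partial Om i g : smooth Om g -> smooth Om (partial i g).
Proof. by move=> [gC]; split=> k; have [_ /(_ i)[]] := gC k.+1. Qed.

Lemma smooth_iter_partial Om g s : smooth Om g -> smooth Om (iter_partial s g).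
Proof.
elim/last_ind: s g => [//|s i ih] g gs.
by rewrite iter_partial_rcons; apply/ih/smooth_partial.
Qed.

Lemma smooth_ccontinuous Om g x : smooth Om g -> Om x -> ccontinuous g x.
Proof. by move=> [gC]; have [+ _] := gC 0; exact. Qed.

Lemma smooth_cderivable Om g i x : smooth Om g -> Om x -> cderivable i g x.
Proof. by move=> [gC]; have [_ /(_ i)[+ _]] := gC 1; exact. Qed.

(** Peeling off the last letter of a word, which is differentiated first, matches
    the recursion of [Ck]. *)
Lemma smoothP Om g : smooth_on Om g <-> smooth Om g.
Proof.
split=> [gs|gs s x Ox]; last first.
  split.
    by case: (smooth_ccontinuous (smooth_iter_partial s gs) Ox).
  by move=> i; case: (smooth_cderivable i (smooth_iter_partial s gs) Ox).
split=> k; elim: k g gs => [|k ih] g gs; split=> //.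
- by move=> x /(gs [::])[gc _]; split.
- by move=> x /(gs [::])[gc _]; split.
- move=> i; split; first by move=> x /(gs [::])[_ /(_ i)[dr di]]; split.
  by apply: ih => s x /(gs (rcons s i)); rewrite iter_partial_rcons.
Qed.

Lemma smooth_eq Om g h : open Om -> (forall x, Om x -> g x = h x) ->
  smooth Om g -> smooth Om h.
Proof. by move=> oO gh [gC]; split=> k; exact: Ck_eq (gC k). Qed.

Lemma smooth_sub Om Om' g : Om `<=` Om' -> smooth Om' g -> smooth Om g.
Proof. by move=> sO /smoothP gs; apply/smoothP => s x /sO; exact: gs. Qed.

Lemma smoothU Om Om' g : smooth Om g -> smooth Om' g -> smooth (Om `|` Om') g.
Proof.
by move=> /smoothP gs /smoothP gs'; apply/smoothP => s x []; [exact: gs|exact: gs'].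
Qed.

Lemma smooth_cst Om (c : Cplx R) : smooth Om (fun=> c).
Proof. by split=> k; exact: Ck_cst. Qed.

Lemma smoothD Om g h : open Om -> smooth Om g -> smooth Om h ->
  smooth Om (fun x => g x + h x).
Proof. by move=> oO [gC] [hC]; split=> k; exact: CkD. Qed.

Lemma smoothM Om g h : open Om -> smooth Om g -> smooth Om h ->
  smooth Om (fun x => g x * h x).
Proof. by move=> oO [gC] [hC]; split=> k; exact: CkM. Qed.

Lemma smoothB Om g h : open Om -> smooth Om g -> smooth Om h ->
  smooth Om (fun x => g x - h x).
Proof.
move=> oO gs hs; under eq_fun do rewrite -mulN1r.
by apply: smoothD => //; apply: smoothM => //; exact: smooth_cst.
Qed.

Lemma smooth_sum (I : Type) (r : seq I) (G : I -> V -> Cplx R) Om : open Om ->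
  (forall k, smooth Om (G k)) -> smooth Om (fun x => \sum_(k <- r) G k x).
Proof.
move=> oO Gs; elim: r => [|k r ih].
  by under eq_fun do rewrite big_nil; exact: smooth_cst.
by under eq_fun do rewrite big_cons; exact: smoothD.
Qed.

Lemma smooth_prod (I : Type) (r : seq I) (G : I -> V -> Cplx R) Om : open Om ->
  (forall k, smooth Om (G k)) -> smooth Om (fun x => \prod_(k <- r) G k x).
Proof.
move=> oO Gs; elim: r => [|k r ih].
  by under eq_fun do rewrite big_nil; exact: smooth_cst.
by under eq_fun do rewrite big_cons; exact: smoothM.
Qed.

Lemma iter_partial_eq Om g h s x : open Om -> (forall x, Om x -> g x = h x) ->
  Om x -> iter_partial s g x = iter_partial s h x.
Proof.
move=> oO gh; elim: s x => [|i s ih] x Ox; first exact: gh.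
by apply: near_partial; exact: filterS (open_nbhs_nbhs (conj oO Ox)).
Qed.

Lemma iter_partial0 s : iter_partial s (fun=> 0 : Cplx R) = (fun=> 0) :> (V -> _).
Proof.
by elim/last_ind: s => // s i ih; rewrite iter_partial_rcons partial_cst.
Qed.

Lemma partial_sum (I : Type) (r : seq I) (G : I -> V -> Cplx R) Om i x : open Om ->
  (forall k, smooth Om (G k)) -> Om x ->
  partial i (fun x => \sum_(k <- r) G k x) x = \sum_(k <- r) partial i (G k) x.
Proof.
move=> oO Gs Ox; elim: r => [|k r ih].
  by rewrite big_nil; under [in LHS]eq_fun do rewrite big_nil; rewrite partial_cst.
rewrite big_cons; under [in LHS]eq_fun do rewrite big_cons.
rewrite partialD ?ih//; first exact: smooth_cderivable (Gs k) Ox.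
by apply: smooth_cderivable Ox; exact: smooth_sum.
Qed.

(** Pairs of words occur with multiplicity, in place of binomial coefficients. *)
Fixpoint splits s : seq (seq 'I_n * seq 'I_n) :=
  if s is i :: s' then
    [seq (i :: p.1, p.2) | p <- splits s'] ++ [seq (p.1, i :: p.2) | p <- splits s']
  else [:: ([::], [::])].

Lemma size_splits s p : p \in splits s -> (size p.2 <= size s)%N.
Proof.
elim: s p => [|i s ih] p /=; first by rewrite inE => /eqP ->.
rewrite mem_cat => /orP[] /mapP[q /ih qs ->] //=; exact: leqW.
Qed.

(** Leibniz' formula: the outermost letter falls on either factor. *)
Lemma iter_partialM Om g h s x : open Om -> smooth Om g -> smooth Om h ->
  Om x -> iter_partial s (fun y => g y * h y) x =
          \sum_(p <- splits s) iter_partial p.1 g x * iter_partial p.2 h x.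
Proof.
move=> oO gs hs; elim: s x => [|i s ih] x Ox; first by rewrite /= big_seq1.
rewrite [LHS](_ : _ = partial i (fun y =>
    \sum_(p <- splits s) iter_partial p.1 g y * iter_partial p.2 h y) x); last first.
  by apply: near_partial; exact: filterS ih (open_nbhs_nbhs (conj oO Ox)).
rewrite (@partial_sum _ _ _ Om)//; last first.
  by move=> p; apply: smoothM => //; exact: smooth_iter_partial.
rewrite big_cat !big_map /= -big_split /=; apply: eq_bigr => p _.
by rewrite partialM//; apply: smooth_cderivable Ox; exact: smooth_iter_partial.
Qed.

Lemma iter_partialB Om g h s x : open Om -> smooth Om g -> smooth Om h ->
  Om x -> iter_partial s (fun y => g y - h y) x =
          iter_partial s g x - iter_partial s h x.
Proof.
move=> oO gs hs; elim: s x => [//|i s ih] x Ox.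
rewrite [LHS](_ : _ = partial i (fun y =>
    iter_partial s g y + (- 1) * iter_partial s h y) x); last first.
  apply: near_partial; apply: filterS (open_nbhs_nbhs (conj oO Ox)) => y Oy.
  by rewrite mulN1r; exact: ih.
have gd := smooth_cderivable i (smooth_iter_partial s gs) Ox.
have hd := smooth_cderivable i (smooth_iter_partial s hs) Ox.
have cd := cderivable_cst i (-1) x.
rewrite partialD//; last exact: cderivableM.
by rewrite partialM// partial_cst mul0r add0r mulN1r.
Qed.

End Smooth.

(** * Flat functions and smooth composites *)

Section Flat.
Context {R : realType}.

(** The functions t^-k exp(-1/t) extended by 0: their span is stable under
    derivation, whence the smoothness of exp(-1/t). *)
Definition flat (k : nat) (t : R) : R :=
  if 0 < t then t^-1 ^+ k * expR (- t^-1) else 0.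

Definition flat' (k : nat) (t : R) : R := flat k.+2 t - k%:R * flat k.+1 t.

Lemma flat_ge0 k t : 0 <= flat k t.
Proof.
rewrite /flat; case: ifP => // t0.
by rewrite mulr_ge0 ?expR_ge0// exprn_ge0// invr_ge0 ltW.
Qed.

Lemma flat_gt0 k t : 0 < t -> 0 < flat k t.
Proof. by move=> t0; rewrite /flat t0 mulr_gt0 ?expR_gt0// exprn_gt0// invr_gt0. Qed.

Lemma flat_eq0 k t : t <= 0 -> flat k t = 0.
Proof. by rewrite /flat leNgt => /negbTE ->. Qed.

(** The exponential series bounds exp(1/t) below by t^-(k+2) / (k+2)!. *)
Lemma flat_le k t : flat k t <= (k.+2)`!%:R * t ^+ 2.
Proof.
have [t0|t0] := ltP 0 t; last by rewrite flat_eq0// mulr_ge0 ?sqr_ge0.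
rewrite /flat t0.
have u0 : 0 < t^-1 by rewrite invr_gt0.
have : t^-1 ^+ k.+2 / (k.+2)`!%:R <= expR t^-1.
  by apply: le_trans (expR_ge1Dxn k.+1 (ltW u0)); rewrite lerDr.
rewrite expRN => h; rewrite ler_pdivrMr ?expR_gt0//.
have f0 : (0 : R) < (k.+2)`!%:R by rewrite ltr0n fact_gt0.
apply: (@le_trans _ _ ((k.+2)`!%:R * t ^+ 2 * (t^-1 ^+ k.+2 / (k.+2)`!%:R))).
  rewrite le_eqVlt; apply/orP; left; apply/eqP.
  rewrite !exprSr exprVn; field.
  by rewrite expf_neq0 ?gt_eqF.
by rewrite ler_wpM2l// mulr_ge0 ?sqr_ge0// ltW.
Qed.

Lemma is_derive_small (f : R -> R) (C : R) : f 0 = 0 ->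
  (forall t, `|f t| <= C * t ^+ 2) -> is_derive (0 : R) (1 : R) f (0 : R).
Proof.
move=> f0 fC.
have C0 : 0 <= C by have := fC 1; rewrite expr1n mulr1; exact: le_trans.
have H : h^-1 *: ((f \o shift 0) (h *: (1 : R)) - f 0) @[h --> 0^'] --> (0 : R).
  apply/cvgrPdist_lt => e e0.
  near=> h.
  have h0 : h != 0 by near: h; exact: nbhs_dnbhs_neq.
  rewrite sub0r normrN /= f0 subr0 addr0 /GRing.scale /= mulr1 normrM normfV.
  rewrite mulrC ltr_pdivrMr ?normr_gt0//.
  apply: le_lt_trans (fC h) _.
  rewrite -real_normK ?num_real// expr2 mulrA ltr_pM2r ?normr_gt0//.
  apply: (@le_lt_trans _ _ ((C + 1) * `|h|)); first by rewrite ler_wpM2r// lerDl.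
  rewrite mulrC -ltr_pdivlMr ?ltr_wpDl//.
  near: h; apply: dnbhs0_lt; by rewrite divr_gt0 ?ltr_wpDl.
split; first by apply/cvg_ex; exists 0.
exact: (cvg_lim _ H).
Unshelve. all: by end_near.
Qed.

(** At 0 the derivative exists and vanishes because of the quadratic bound. *)
Lemma is_derive_flat k (t : R) : is_derive t 1 (flat k) (flat' k t).
Proof.
have [t0|t0|t0] := ltgtP 0 t; last first; first rewrite -t0.
- rewrite /flat' !flat_eq0// mulr0 subrr.
  apply: (@is_derive_small _ (k.+2)`!%:R); first by rewrite flat_eq0.
  by move=> t'; rewrite ger0_norm ?flat_ge0// flat_le.
- rewrite /flat' !flat_eq0 ?ltW// mulr0 subrr.
  apply: (@near_eq_is_derive _ _ _ (cst 0)).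
  near=> s; rewrite flat_eq0// ltW//; near: s; exact: lt_nbhsl.
- have dV : is_derive t 1 (fun s : R => s^-1) (- t ^- 2 *: 1).
    by apply: is_deriveV; rewrite gt_eqF.
  have dE : is_derive t 1 (fun s : R => expR (- s^-1)) (expR (- t^-1) * t ^- 2).
    have -> : (fun s : R => expR (- s^-1)) = expR \o (fun s => - s^-1) by [].
    have -> : expR (- t^-1) * t ^- 2 = expR (- t^-1) * - (- t ^- 2 *: 1).
      by rewrite /GRing.scale /= mulr1 opprK.
    exact: is_derive1_comp.
  have dX : is_derive t 1 (fun s : R => s^-1 ^+ k) (k%:R * t^-1 ^+ k.-1 * - t ^- 2).
    have -> : (fun s : R => s^-1 ^+ k) = (fun s : R => s^-1) ^+ k by apply/funext => s; rewrite fctE.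
    apply: (is_derive_eq (is_deriveX k dV)).
    by rewrite /GRing.scale /= mulr1.
  have D : is_derive t 1 (fun s : R => s^-1 ^+ k * expR (- s^-1)) (flat' k t).
    apply: (is_derive_eq (is_deriveM dX dE)); rewrite /flat' /flat t0 /GRing.scale /=.
    case: (k) => [|m] /=; first by rewrite !mul0r !mulr0; field; rewrite gt_eqF.
    rewrite !exprSr exprVn; field.
    by rewrite ?expf_neq0 gt_eqF.
  apply: near_eq_is_derive D; near=> s; rewrite /flat ifT//.
  by near: s; exact: lt_nbhsr.
Unshelve. all: by end_near.
Qed.

End Flat.

Section Chain.
Context {R : realType} {V : normedModType R}.

(** A directional derivative only sees the line through x, so the chain rule of
    one variable suffices, without any total differentiability. *)
Lemma is_derive_line (f : V -> R) (x v : V) (a : R) :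
  is_derive (0 : R) (1 : R) (fun h => f (h *: v + x)) a <-> is_derive x v f a.
Proof.
pose g1 (h : R) := h^-1 *: (((fun h => f (h *: v + x)) \o shift 0) (h *: (1 : R)) - f (0 *: v + x)).
pose g2 (h : R) := h^-1 *: ((f \o shift x) (h *: v) - f x).
have E : g1 = g2.
  by apply/funext => h; rewrite /g1 /g2 /= addr0 scale0r add0r /GRing.scale /= mulr1.
have D : 'D_1 (fun h : R => f (h *: v + x)) 0 = 'D_v f x.
  by rewrite /derive -/g2 -E.
split=> -[d d']; split.
- exact: (proj2 (derivable1P f x v) d).
- by rewrite -D.
- exact: (proj1 (derivable1P f x v) d).
- by rewrite D.
Qed.

Lemma is_derive_comp (phi : R -> R) (f : V -> R) (x v : V) (a b : R) :
  is_derive (f x) (1 : R) phi a -> is_derive x v f b ->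
  is_derive x v (fun y => phi (f y)) (a * b).
Proof.
move=> dphi /is_derive_line df; apply/is_derive_line.
apply: (@is_derive1_comp _ phi (fun h => f (h *: v + x))) => //.
by rewrite scale0r add0r.
Qed.

End Chain.

Section SmoothFunctions.
Context {R : realType} {n : nat}.
Local Notation V := 'rV[R]_n.
Implicit Types (g h : V -> Cplx R) (Om : set V) (i : 'I_n) (x : V).

Definition repart g : V -> Cplx R := fun x => Complex (Re (g x)) 0.

Definition flat_comp (k : nat) g : V -> Cplx R := fun x => Complex (flat k (Re (g x))) 0.

Lemma ccontinuous_real (f : V -> R) x : {for x, continuous f} ->
  ccontinuous (fun y => Complex (f y) 0 : Cplx R) x.
Proof.
move=> fc; split.
apply/(cvg_ReIm (nbhs_filter x) (fun y => Complex (f y) 0) (Complex (f x) 0)).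
split; first exact: fc.
exact: (@cvg_cst _ (0 : R)).
Qed.

Lemma ccontinuous_Re g x : ccontinuous g x -> {for x, continuous (fun y => Re (g y))}.
Proof. by move=> [/cvg_ReIm[]]. Qed.

Lemma Ck_repart k Om g : Ck k Om g -> Ck k Om (repart g).
Proof.
elim: k g => [|k ih] g [gc gd]; split=> //.
- by move=> x /gc /ccontinuous_Re; exact: ccontinuous_real.
- by move=> x /gc /ccontinuous_Re; exact: ccontinuous_real.
move=> i; have [gi gp] := gd i; split.
  by move=> x /gi[gr _]; split=> //=; exact: derivable_cst.
have -> : partial i (repart g) = repart (partial i g).
  by apply/funext => x; apply: cplx_eqP => //=; rewrite derive_cst.
exact: ih.
Qed.

Lemma is_derive_flat_comp k i g x : cderivable i g x ->
  is_derive x (delta_mx 0 i) (fun y => flat k (Re (g y)))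
    (flat' k (Re (g x)) * Re (partial i g x)).
Proof.
move=> [/derivableP gr _]; exact: (is_derive_comp (is_derive_flat k (Re (g x))) gr).
Qed.

Lemma partial_flat_comp k i g x : cderivable i g x ->
  partial i (flat_comp k g) x =
  (flat_comp k.+2 g x + Complex (- k%:R) 0 * flat_comp k.+1 g x) * repart (partial i g) x.
Proof.
move=> /(is_derive_flat_comp k)[_ D].
apply: cplx_eqP; rewrite ?ReM ?ImM ?ReD ?ImD ?ReM ?ImM /=.
  by rewrite D /flat' /=; ring.
by rewrite derive_cst; ring.
Qed.

Lemma ccontinuous_flat_comp m g x : ccontinuous g x -> ccontinuous (flat_comp m g) x.
Proof.
move=> /ccontinuous_Re gc; apply: ccontinuous_real.
apply: (continuous_comp gc).
apply/differentiable_continuous/derivable1_diffP.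
by have [] := is_derive_flat m (Re (g x)).
Qed.

(** The induction must vary m, since differentiation raises the index of the flat
    function by one or two. *)
Lemma Ck_flat_comp k m Om g : open Om -> Ck k Om g -> Ck k Om (flat_comp m g).
Proof.
move=> oO; elim: k m g => [|k ih] m g gk; have [gc gd] := gk; split=> //;
  try by move=> x /gc; exact: ccontinuous_flat_comp.
move=> i; have [gi gp] := gd i; split.
  move=> x /gi /(is_derive_flat_comp m)[dr _]; split=> //=; exact: derivable_cst.
apply: (@Ck_eq _ _ _ _ (fun x => (flat_comp m.+2 g x +
    Complex (- m%:R) 0 * flat_comp m.+1 g x) * repart (partial i g) x)) => //.
  by move=> x Ox; rewrite partial_flat_comp//; exact: gi.
have g1 := CkW gk.
apply: CkM => //; last exact: Ck_repart.
by apply: CkD => //; [exact: ih|apply: CkM; [|exact: Ck_cst|exact: ih]].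
Qed.

Lemma smooth_flat_comp m Om g : open Om -> smooth Om g -> smooth Om (flat_comp m g).
Proof. by move=> oO [gC]; split=> k; exact: Ck_flat_comp. Qed.

Lemma is_derive_coord i (j : 'I_n) x :
  is_derive x (delta_mx 0 i) (fun y : V => y 0 j) ((j == i)%:R : R).
Proof.
apply/is_derive_line.
have -> : (fun t : R => (t *: delta_mx 0 i + x) 0 j) = (fun t : R => t * (j == i)%:R + x 0 j).
  by apply/funext => h; rewrite !mxE eqxx.
have := is_deriveD
  (is_deriveM (is_derive_id (0 : R) (1 : R)) (is_derive_cst ((j == i)%:R : R) (0 : R) (1 : R)))
  (is_derive_cst (x 0 j) (0 : R) (1 : R)).
rewrite (_ : _ + _ = fun t : R => t * (j == i)%:R + x 0 j)//.
by move/is_derive_eq; apply; rewrite /GRing.scale /= mul0r add0r addr0 mulr1.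
Qed.

Lemma smooth_coord Om (j : 'I_n) : smooth Om (fun x => Complex (x 0 j) 0).
Proof.
have ctn (x : V) : ccontinuous (fun x => Complex (x 0 j) 0 : Cplx R) x.
  by apply: ccontinuous_real; exact: coord_continuous.
split=> -[|k]; split=> //.
move=> i; split.
  by move=> x _; have [d _] := is_derive_coord i j x; split=> //=; exact: derivable_cst.
rewrite (_ : partial i _ = fun=> Complex (j == i)%:R 0); first exact: Ck_cst.
apply/funext => x; have [_ d] := is_derive_coord i j x.
by apply: cplx_eqP => //=; rewrite derive_cst.
Qed.

End SmoothFunctions.

(** * Test functions, cut-offs and partitions of unity *)

Section TestFunctions.
Context {R : realType} {n : nat}.
Local Notation V := 'rV[R]_n.
Implicit Types (g h phi psi : V -> Cplx R) (Om U A K : set V) (x c : V).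

Lemma closed_fsupp g : closed (fsupp g).
Proof. exact: closed_closure. Qed.

Lemma fsupp_sub g A : closed A -> (forall x, g x != 0 -> A x) -> fsupp g `<=` A.
Proof. by move=> Acl gA; rewrite [X in _ `<=` X](closure_id A).1//; exact: closureS. Qed.

Lemma notin_fsupp g x : ~ fsupp g x -> g x = 0.
Proof. by move=> gx; apply/eqP/negPn/negP => gx0; apply: gx; exact: subset_closure. Qed.

Lemma fsuppMr g h : fsupp (fun x => g x * h x) `<=` fsupp h.
Proof.
apply: fsupp_sub; first exact: closed_fsupp.
by move=> x; rewrite mulf_eq0 negb_or => /andP[_ ?]; exact: subset_closure.
Qed.

Lemma fsuppMl g h : fsupp (fun x => g x * h x) `<=` fsupp g.
Proof.
apply: fsupp_sub; first exact: closed_fsupp.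
by move=> x; rewrite mulf_eq0 negb_or => /andP[? _]; exact: subset_closure.
Qed.

Lemma fsuppD g h : fsupp (fun x => g x + h x) `<=` fsupp g `|` fsupp h.
Proof.
apply: fsupp_sub; first by apply: closedU; exact: closed_fsupp.
move=> x gh; apply: contrapT => /not_orP[/notin_fsupp gx /notin_fsupp hx].
by move: gh; rewrite gx hx addr0 eqxx.
Qed.

Lemma fsupp0 : fsupp (fun=> 0 : Cplx R) = set0 :> set V.
Proof.
apply/seteqP; split=> // x; suff : ~ fsupp (fun=> 0 : Cplx R) x by [].
by move=> /(fsupp_sub closed0); apply => y; rewrite eqxx.
Qed.

(** Sealed for the same reason as [cderivable]. *)
Variant test Om phi : Prop :=
  Test of smooth setT phi & compact (fsupp phi) & fsupp phi `<=` Om.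

Lemma testP Om phi : test_on Om phi <-> test Om phi.
Proof.
by split=> [[/smoothP ps pc pO]|[/smoothP ps pc pO]]; split.
Qed.

Lemma test_sub Om U phi : Om `<=` U -> test Om phi -> test U phi.
Proof. by move=> OU [ps pc pO]; split=> //; exact: subset_trans OU. Qed.

Lemma testT Om phi : test Om phi -> test setT phi.
Proof. by apply: test_sub. Qed.

Lemma test_fsupp Om phi A : fsupp phi `<=` A -> test Om phi -> test A phi.
Proof. by move=> pA [ps pc pO]; split. Qed.

Lemma test0 Om : test Om (fun=> 0).
Proof. by split; rewrite ?fsupp0//; [exact: smooth_cst|exact: compact0]. Qed.

Lemma testD Om phi psi : test Om phi -> test Om psi ->
  test Om (fun x => phi x + psi x).
Proof.
move=> [phis phic phiO] [psis psic psiO]; split.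
- by apply: smoothD => //; exact: openT.
- apply: subclosed_compact (compactU phic psic) _; first exact: closed_fsupp.
  exact: fsuppD.
- by move=> x /fsuppD[/phiO|/psiO].
Qed.

(** The open sets Om and the complement of the support of phi cover the space;
    on the second one the product vanishes, whatever the values of g. *)
Lemma testM Om g phi : open Om -> smooth Om g -> test Om phi ->
  test Om (fun x => g x * phi x).
Proof.
move=> oO gs [ps pc pO]; split.
- rewrite -(_ : Om `|` ~` fsupp phi = setT); last first.
    apply/seteqP; split=> // x _; have [/pO|?] := pselect (fsupp phi x); by [left|right].
  apply: smoothU.
    by apply: smoothM => //; exact: smooth_sub ps.
  have oS : open (~` fsupp phi) by apply: closed_openC; exact: closed_fsupp.
  apply: (@smooth_eq _ _ _ (fun=> 0)) => //; last exact: smooth_cst.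
  by move=> x /notin_fsupp ->; rewrite mulr0.
- apply: subclosed_compact pc _; first exact: closed_fsupp.
  exact: fsuppMr.
- exact: subset_trans (@fsuppMr _ _) pO.
Qed.

Lemma testZ Om (a : Cplx R) phi : test Om phi -> test Om (fun x => a * phi x).
Proof.
move=> pt.
apply: test_fsupp (testM openT _ (testT pt)); last exact: smooth_cst.
by case: pt => _ _ pO; exact: subset_trans (@fsuppMr _ _) pO.
Qed.

Lemma test_smooth Om U phi : test Om phi -> smooth U phi.
Proof. by move=> [ps _ _]; exact: smooth_sub ps. Qed.

Lemma testMtest Om U phi psi : test U phi -> test Om psi ->
  test U (fun x => phi x * psi x).
Proof.
move=> pt qt; case: (pt) => _ _ pU.
apply: test_fsupp (testM openT (test_smooth _ pt) (testT qt)).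
exact: subset_trans (@fsuppMl _ _) pU.
Qed.

Lemma testB Om phi psi : test Om phi -> test Om psi ->
  test Om (fun x => phi x - psi x).
Proof.
by move=> pt qt; under eq_fun do rewrite -mulN1r; apply: testD => //; exact: testZ.
Qed.

(** A product of one-variable bumps; its support is a box, that is, a ball of the
    maximum norm. *)
Definition bump c (r : R) x : R := \prod_(j < n) flat 0 (r ^+ 2 - (x 0 j - c 0 j) ^+ 2).

Lemma bump_ge0 c r x : 0 <= bump c r x.
Proof. by apply: prodr_ge0 => j _; exact: flat_ge0. Qed.

Lemma bump_gt0 c r : 0 < r -> 0 < bump c r c.
Proof.
move=> r0; apply: prodr_gt0 => j _; apply: flat_gt0.
by rewrite subrr expr0n /= subr0 exprn_gt0.
Qed.

Lemma bump_neq0 c r x : 0 < r -> bump c r x != 0 -> forall j, `|x 0 j - c 0 j| <= r.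
Proof.
move=> r0 /prodf_neq0 bx j; rewrite leNgt; apply/negP => rx.
have /eqP := bx j erefl; apply; apply: flat_eq0.
by rewrite subr_le0 -(real_normK (num_real (x 0 j - c 0 j))) lerXn2r ?nnegrE// ltW.
Qed.

Lemma smooth_bump Om c r : open Om -> smooth Om (fun x => Complex (bump c r x) 0).
Proof.
move=> oO.
have s1 j : smooth Om (fun x => Complex (r ^+ 2) 0 - (Complex (x 0 j) 0 - Complex (c 0 j) 0)
    * (Complex (x 0 j) 0 - Complex (c 0 j) 0)).
  apply: smoothB => //; first exact: smooth_cst.
  by apply: smoothM => //; apply: smoothB => //; solve [exact: smooth_coord|exact: smooth_cst].
have := smooth_prod (index_enum 'I_n) oO (fun j => smooth_flat_comp 0 oO (s1 j)).
apply: smooth_eq => // x Ox.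
rewrite -[RHS]/((bump c r x)%:C)%C rmorph_prod; apply: eq_bigr => j _.
congr (Complex (flat 0 _) 0); rewrite ReB ReM !ReB !ImB /=.
by rewrite !subrr mulr0 subr0 -expr2.
Qed.

Lemma compact_box c (r : R) : compact [set x : V | forall j, `|x 0 j - c 0 j| <= r].
Proof.
have -> : [set x : V | forall j, `|x 0 j - c 0 j| <= r] =
    [set x : V | forall j, [set` `[c 0 j - r, c 0 j + r]] (x ord0 j)].
  by apply/seteqP; split=> x /= xc j; have := xc j; rewrite in_itv /= ler_distl.
exact: (@rV_compact R n (fun j => [set` `[c 0 j - r, c 0 j + r]])
  (fun j => @segment_compact _ _ _)).
Qed.

Lemma nbhs_box c U : nbhs c U ->
  exists2 r : R, 0 < r & [set x : V | forall j, `|x 0 j - c 0 j| <= r] `<=` U.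
Proof.
move=> /nbhs_ballP[e /= e0 eU]; exists (e / 2); first exact: divr_gt0.
move=> x xc; apply: eU; split=> // i j; rewrite ord1 /ball /= distrC.
by apply: le_lt_trans (xc j) _; rewrite ltr_pdivrMr// mulr_natr mulr2n ltrDl.
Qed.

Lemma exists_bump U c : nbhs c U -> exists b : V -> R,
  [/\ forall x, 0 <= b x, 0 < b c & test U (fun x => Complex (b x) 0)].
Proof.
move=> /nbhs_box[r r0 rU]; exists (bump c r); split.
- exact: bump_ge0.
- exact: bump_gt0.
have bS : fsupp (fun x => Complex (bump c r x) 0 : Cplx R) `<=` [set x : V | forall j, `|x 0 j - c 0 j| <= r].
  apply: fsupp_sub.
    by apply: compact_closed; [exact: norm_hausdorff|exact: compact_box].
  move=> x bx /=; apply: bump_neq0 => //; apply: contra bx => /eqP ->.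
  exact: eqxx.
split; first by apply: smooth_bump; exact: openT.
- apply: subclosed_compact bS; [exact: closed_fsupp|exact: compact_box].
- exact: subset_trans bS rU.
Qed.

Lemma flat0_le (s t : R) : s <= t -> flat 0 s <= flat 0 t.
Proof.
move=> st; have [s0|s0] := ltP 0 s; last by rewrite flat_eq0 ?flat_ge0.
have t0 := lt_le_trans s0 st.
by rewrite /flat s0 t0 !expr0 !mul1r ler_expR lerN2 lef_pV2.
Qed.

(** flat 0 (flat 0 1 - flat 0 t) is constant for t <= 0 and vanishes for t >= 1:
    composing flat functions gives an exact step without any division. *)
Lemma exists_plateau U c : nbhs c U ->
  exists2 beta, test U beta & \forall x \near c, beta x = 1.
Proof.
move=> /exists_bump[b [b0 bc bt]].
pose m := flat 0 (flat 0 1) : R.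
have m0 : 0 < m by rewrite !flat_gt0.
(* With the factor 2 / b c, the function s exceeds 1 where b > b c / 2. *)
pose s x : Cplx R := Complex (2 / b c) 0 * Complex (b x) 0.
have ss : smooth setT s by apply: smoothM; [exact: openT|exact: smooth_cst|exact: test_smooth bt].
pose beta x : Cplx R := 1 - Complex m^-1 0 * flat_comp 0 (fun x => Complex (flat 0 1) 0 - flat_comp 0 s x) x.
have betas : smooth setT beta.
  apply: smoothB; [exact: openT|exact: smooth_cst|].
  apply: smoothM; [exact: openT|exact: smooth_cst|].
  apply: smooth_flat_comp; first exact: openT.
  apply: smoothB; [exact: openT|exact: smooth_cst|].
  by apply: smooth_flat_comp; first exact: openT.
have betaE x : beta x = Complex (1 - m^-1 * flat 0 (flat 0 1 - flat 0 (2 / b c * b x))) 0.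
  by apply: cplx_eqP; rewrite /beta ?ReB ?ImB ?ReM ?ImM /=; rewrite ?mul0r ?mulr0 ?subr0 ?addr0 ?subrr.
exists beta.
  case: bt => _ bcomp bU.
  have bS : fsupp beta `<=` fsupp (fun x => Complex (b x) 0 : Cplx R).
    apply: fsupp_sub; first exact: closed_fsupp.
    move=> x /eqP bx; apply: contrapT => /notin_fsupp[bx0]; apply: bx.
    rewrite betaE bx0 mulr0 (@flat_eq0 _ _ 0)// subr0 mulVf ?subrr//.
    by rewrite gt_eqF.
  split=> //; last exact: subset_trans bS bU.
  by apply: subclosed_compact bS => //; exact: closed_fsupp.
have bcont : {for c, continuous b}.
  exact: (ccontinuous_Re (smooth_ccontinuous (test_smooth setT bt) I)).
have : \forall x \near c, b c / 2 < b x.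
  apply: (cvgr_gt _ bcont).
  by rewrite ltr_pdivrMr// ltr_pMr// ltr1n.
apply: filterS => x bx; rewrite betaE flat_eq0 ?mulr0 ?subr0//.
rewrite subr_le0; apply: flat0_le.
rewrite mulrAC ler_pdivlMr// mul1r mulrC -ler_pdivrMr//.
exact: ltW.
Qed.

(** The product of the factors 1 - beta_c vanishes near K; working with it instead
    of the sum of the beta_c avoids normalizing by a quotient. *)
Lemma finite_plateaus (W : V -> set V) K : compact K ->
  (forall x, K x -> nbhs x (W x)) ->
  exists (l : seq V) (beta : V -> V -> Cplx R),
    (forall c, c \in l -> K c /\ test (W c) (beta c)) /\
    (forall x, K x -> \forall y \near x, \prod_(c <- l) (1 - beta c y) = 0).
Proof.
move=> Kc KW.
have /choice[beta betaP] : forall x, exists beta, K x ->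
    test (W x) beta /\ (\forall y \near x, beta y = 1).
  move=> x; have [/KW|?] := pselect (K x); last by exists (fun=> 0).
  by move=> /exists_plateau[b bt b1]; exists b.
move: Kc; rewrite compact_cover => /(_ V K (fun x => [set y | beta x y = 1]°)).
case=> [x Kx|x Kx|D DK KD]; first exact: open_interior.
  by exists x => //; have [] := betaP x Kx.
exists (finmap.enum_fset D), beta; split=> [c cD|x /KD[c /= cD cx]].
  by have /[!inE] Kc := DK c cD; have [] := betaP c Kc.
apply: filterS cx => y /= cy.
by rewrite (big_rem c)//= cy subrr mul0r.
Qed.

(** Partition of unity, packaged as an induction principle: a property of test
    functions that is stable under sums may be checked on small supports. Given
    plateaus beta_c such that the product of all 1 - beta_c kills phi, one splits
    phi = beta_c phi + (1 - beta_c) phi and inducts on the list of the c. *)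
Lemma test_ind (P : (V -> Cplx R) -> Prop) phi :
  P (fun=> 0) -> (forall phi psi, P phi -> P psi -> P (fun x => phi x + psi x)) ->
  (forall x, fsupp phi x -> exists2 U, open_nbhs x U & forall psi, test U psi -> P psi) ->
  test setT phi -> P phi.
Proof.
move=> P0 PD Ploc pt.
have /choice[W WP] : forall x, exists U, fsupp phi x -> open_nbhs x U /\ forall psi, test U psi -> P psi.
  move=> x; have [/Ploc[U xU UP]|?] := pselect (fsupp phi x); last by exists set0.
  by exists U.
have [ps pc _] := pt.
have [x px|l [beta [lb lp]]] := @finite_plateaus W _ pc.
  by apply: open_nbhs_nbhs; have [] := WP x px.
have {lp} : forall x, \prod_(c <- l) (1 - beta c x) * phi x = 0.
  move=> x; have [/lp/nbhs_singleton ->|/notin_fsupp ->] := pselect (fsupp phi x).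
    by rewrite mul0r.
  by rewrite mulr0.
move: pt {Ploc pc ps}.
have {lb} : forall c, c \in l ->
    open (W c) /\ test (W c) (beta c) /\ forall psi, test (W c) psi -> P psi.
  by move=> c /lb[/WP[[? ?] ?] ?].
elim: l phi {WP} => [|c l ih] phi lb pt p0.
  rewrite (_ : phi = fun=> 0)//; apply/funext => x.
  by have := p0 x; rewrite big_nil mul1r.
have [oW [bt WP]] := lb c (mem_head _ _).
rewrite (_ : phi = fun x => beta c x * phi x + (1 - beta c x) * phi x); last first.
  by apply/funext => x; rewrite -mulrDl addrC subrK mul1r.
apply: PD; first by apply: WP; exact: testMtest bt pt.
apply: ih.
- by move=> d dl; apply: lb; rewrite in_cons dl orbT.
- apply: testM pt; first exact: openT.
  by apply: smoothB; [exact: openT|exact: smooth_cst|exact: test_smooth bt].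
- by move=> x; rewrite mulrA [X in X * _]mulrC; have := p0 x; rewrite big_cons.
Qed.

Lemma exists_cutoff K U : compact K -> open U -> K `<=` U ->
  exists2 chi, test U chi & one_around K chi.
Proof.
move=> Kc oU KU.
have [x /KU Ux|l [beta [lb lp]]] := @finite_plateaus (fun=> U) _ Kc.
  exact: open_nbhs_nbhs.
exists (fun x => 1 - \prod_(c <- l) (1 - beta c x)); last first.
  by move=> x /lp; apply: filterS => y ->; rewrite subr0.
have {lb lp} : forall c, c \in l -> test U (beta c) by move=> c /lb[].
elim: l => [|c l ih] lb.
  rewrite (_ : (fun x => _) = fun=> 0); first exact: test0.
  by apply/funext => x; rewrite big_nil subrr.
rewrite (_ : (fun x => _) = fun x =>
    beta c x + (1 - beta c x) * (1 - \prod_(j <- l) (1 - beta j x))); last first.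
  by apply/funext => x; rewrite big_cons; ring.
have bt := lb c (mem_head _ _).
apply: testD => //; apply: testM => //.
  by apply: smoothB => //; [exact: smooth_cst|exact: test_smooth bt].
by apply: ih => d dl; apply: lb; rewrite in_cons dl orbT.
Qed.

End TestFunctions.

(** * Iterated integrals of compactly supported functions *)

Section OneVariable.
Context {R : realType}.
Implicit Types (F G : R -> R) (M : R).
Local Notation mu := (@lebesgue_measure R).

(** Uniform rather than plain continuity, and an explicit bound of the support:
    these data are inherited by the integral over all variables but one. *)
Definition Cc1 M F : Prop :=
  (forall e : R, 0 < e -> exists2 d : R, 0 < d & forall s t, `|s - t| < d -> `|F s - F t| <= e) /\
  (forall t, F t != 0 -> `|t| <= M).

Lemma Cc1_continuous M F : Cc1 M F -> continuous F.
Proof.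
move=> [Fc _] t; apply/cvgrPdist_le => e /Fc[d d0 Fd].
by near=> s; apply: Fd; near: s; exact: cvgr_dist_lt.
Unshelve. all: by end_near.
Qed.

Lemma Cc1_patch M F : Cc1 M F -> F = F \_ `[- M, M]%classic.
Proof.
move=> [_ FM]; apply/funext => t; rewrite patchE.
case: ifPn => // tM; apply/eqP/negPn/negP => /FM tM'; move/negP: tM; apply.
by rewrite inE /= in_itv /= -ler_norml.
Qed.

Lemma Cc1_integrable M F : Cc1 M F -> mu.-integrable setT (EFin \o F).
Proof.
move=> Fc; have : mu.-integrable `[- M, M]%classic (EFin \o F).
  apply: continuous_compact_integrable; first exact: segment_compact.
  by apply: continuous_subspaceT; exact: Cc1_continuous Fc.
rewrite integrable_mkcond//; congr (_.-integrable _ _).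
by apply/funext => t; rewrite /= {2}(Cc1_patch Fc) !patchE; case: ifP.
Qed.

Lemma Cc1_integral_le M F (B : R) : 0 <= M -> Cc1 M F -> (forall t, `|F t| <= B) ->
  `|Rintegral mu setT F| <= 2 * M * B.
Proof.
move=> M0 Fc FB; rewrite (Cc1_patch Fc) -Rintegral_mkcond.
have iF : mu.-integrable `[- M, M]%classic (EFin \o F).
  by apply: integrableS (Cc1_integrable Fc).
apply: le_trans (le_normr_Rintegral _ iF) _ => //.
have muM : mu `[- M, M]%classic = (2 * M)%:E.
  rewrite lebesgue_measure_itv /= lte_fin.
  have [|M0'] := ltP (- M) M; first by rewrite -EFinD opprK mulr_natl mulr2n.
  have -> : M = 0 by apply/eqP; rewrite eq_le M0 andbT; lra.
  by rewrite mulr0.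
apply: (@le_trans _ _ (\int[mu]_(t in `[- M, M]%classic) B)).
  apply: le_Rintegral => //; first exact: integrable_norm iF.
  apply/integrableP; split; first exact: measurable_cst.
  by rewrite integral_cst//= muM -EFinM ltry.
rewrite Rintegral_cst//.
have -> : fine (mu `[- M, M]%classic) = 2 * M by rewrite muM.
by rewrite mulrC.
Qed.

(** F stays above F t0 / 2 on an interval of positive length. *)
Lemma Cc1_integral_gt0 M F (t0 : R) : Cc1 M F -> (forall t, 0 <= F t) -> 0 < F t0 ->
  0 < Rintegral mu setT F.
Proof.
move=> Fc F0 Ft0; have [Fu _] := Fc.
have e0 : 0 < F t0 / 2 by rewrite divr_gt0.
have [d d0 Fd] := Fu _ e0.
pose A := `[t0, t0 + d / 2]%classic : set R.
have d20 : 0 < d / 2 by rewrite divr_gt0.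
have muA : mu A = (d / 2)%:E.
  by rewrite /A lebesgue_measure_itv /= lte_fin ltrDl d20 -EFinD addrC addKr.
have iF := Cc1_integrable Fc.
have mA : measurable A by exact: measurable_itv.
have iFA : mu.-integrable A (EFin \o F) by apply: integrableS iF.
have -> : Rintegral mu setT F = Rintegral mu A F + Rintegral mu (~` A) F.
  rewrite -Rintegral_setU//.
  - by rewrite setUv.
  - exact: measurableC.
  - by rewrite setUv.
  - by apply/disj_setPS; rewrite setICr.
apply: ltr_wpDr; first by apply: Rintegral_ge0 => t _.
apply: (@lt_le_trans _ _ (\int[mu]_(t in A) (F t0 / 2))).
  rewrite Rintegral_cst//; have -> : fine (mu A) = d / 2 by rewrite muA.
  by rewrite mulr_gt0.
apply: le_Rintegral => //.
  apply/integrableP; split; first exact: measurable_cst.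
  by rewrite integral_cst//= muA -EFinM ltry.
move=> t; rewrite /A /= in_itv /= => /andP[t1 t2].
have : `|t0 - t| < d.
  by rewrite distrC ger0_norm ?subr_ge0// ltrBlDl; lra.
move=> /Fd; rewrite ler_norml => /andP[_]; lra.
Qed.

End OneVariable.

Section IteratedIntegral.
Context {R : realType}.
Implicit Types M : R.

Definition Cc m M (f : 'rV[R]_m -> R) : Prop :=
  (forall e : R, 0 < e -> exists2 d : R, 0 < d &
     forall x y : 'rV[R]_m, (forall j, `|x 0 j - y 0 j| < d) -> `|f x - f y| <= e) /\
  (forall x, f x != 0 -> forall j, `|x 0 j| <= M).

Definition slice m (f : 'rV[R]_m.+1 -> R) (t : R) : 'rV[R]_m -> R :=
  fun y => f (row_mx (t%:M : 'rV[R]_1) y).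

Lemma iter_integralS m (f : 'rV[R]_m.+1 -> R) : iter_integral f =
  Rintegral lebesgue_measure setT (fun t => iter_integral (slice f t)).
Proof. by []. Qed.

Lemma row_mx_coord m (t : R) (y : 'rV[R]_m) (j : 'I_m.+1) :
  (row_mx (t%:M : 'rV[R]_1) y : 'rV[R]_m.+1) 0 j =
  match fintype.split (j : 'I_(1 + m)) with inl _ => t | inr k => y 0 k end.
Proof. by rewrite mxE; case: fintype.split => // k; rewrite !ord1 mxE eqxx. Qed.

Lemma row_mx_eta m (x : 'rV[R]_m.+1) :
  x = row_mx (((x : 'rV[R]_(1 + m)) 0 0)%:M : 'rV[R]_1) (rsubmx (x : 'rV[R]_(1 + m))).
Proof.
apply/rowP => j; rewrite row_mx_coord.
case: splitP => k jk; last by rewrite mxE; congr (x _ _); apply/val_inj.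
by congr (x _ _); apply/val_inj => /=; rewrite jk ord1.
Qed.

Lemma Cc_slice m M (f : 'rV[R]_m.+1 -> R) t : Cc M f -> Cc M (slice f t).
Proof.
move=> [fu fM]; split=> [e /fu[d d0 fd]|y /fM yM j].
  exists d => // x y xy; apply: fd => j; rewrite !row_mx_coord.
  by case: fintype.split => // k; rewrite subrr normr0.
have := yM (rshift 1 j : 'I_m.+1); rewrite row_mx_coord.
by rewrite (unsplitK (inr j : 'I_1 + 'I_m)).
Qed.

Lemma slice_out m M (f : 'rV[R]_m.+1 -> R) t : Cc M f -> M < `|t| -> slice f t = fun=> 0.
Proof.
move=> [_ fM] Mt; apply/funext => y; apply/eqP/negPn/negP => /fM /(_ (lshift m (ord0 : 'I_1) : 'I_(1 + m))).
rewrite row_mx_coord (unsplitK (inl ord0 : 'I_1 + 'I_m)).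
by rewrite leNgt Mt.
Qed.

Lemma Cc_lin m M (f g : 'rV[R]_m -> R) (a : R) : Cc M f -> Cc M g ->
  Cc M (fun x => f x + a * g x).
Proof.
move=> [fu fM] [gu gM]; split=> [e e0|x fg j].
  have e20 : 0 < e / 2 by rewrite divr_gt0.
  have a10 : 0 < `|a| + 1 by rewrite ltr_wpDl.
  have [d d0 fd] := fu _ e20.
  have [d' d'0 gd] := gu _ (divr_gt0 e20 a10).
  exists (Num.min d d'); first by rewrite lt_min d0.
  move=> x y xy; rewrite opprD addrACA -mulrBr [e]splitr.
  apply: le_trans (ler_normD _ _) _; apply: lerD.
    by apply: fd => j; apply: lt_le_trans (xy j) _; rewrite ge_min lexx.
  rewrite normrM; apply: (@le_trans _ _ ((`|a| + 1) * (e / 2 / (`|a| + 1)))).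
    apply: ler_pM => //; first by rewrite lerDl.
    by apply: gd => j; apply: lt_le_trans (xy j) _; rewrite ge_min lexx orbT.
  by rewrite mulrCA mulfV ?mulr1// gt_eqF.
have [fx0|/fM] := eqVneq (f x) 0; last exact.
apply: gM; apply: contra fg => /eqP ->; by rewrite fx0 mulr0 addr0.
Qed.

Definition integral_bound m := forall M (f : 'rV[R]_m -> R) (B : R),
  0 <= M -> Cc M f -> (forall x, `|f x| <= B) -> `|iter_integral f| <= (2 * M) ^+ m * B.

Definition integral_linear m := forall M (f g : 'rV[R]_m -> R) (a : R),
  0 <= M -> Cc M f -> Cc M g ->
  iter_integral (fun x => f x + a * g x) = iter_integral f + a * iter_integral g.

(** The difference of two inner integrals is the integral of a uniformly small
    function over a box of fixed size. *)
Lemma Cc1_slices m M (f : 'rV[R]_m.+1 -> R) :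
  integral_bound m -> integral_linear m -> 0 <= M -> Cc M f ->
  Cc1 M (fun t => iter_integral (slice f t)).
Proof.
move=> Ib Il M0 fc; have [fu fM] := fc.
pose k : R := (2 * M) ^+ m + 1.
have k0 : 0 < k by rewrite ltr_wpDl// exprn_ge0// mulr_ge0.
split=> [e e0|t It].
  have [d d0 fd] := fu _ (divr_gt0 e0 k0).
  exists d => // s t st.
  rewrite -[X in _ - X]mul1r -mulNr -(Il M)//; [|exact: Cc_slice..].
  apply: (@le_trans _ _ ((2 * M) ^+ m * (e / k))).
    apply: Ib => //; first by apply: Cc_lin; exact: Cc_slice.
    move=> y; rewrite mulN1r; apply: fd => j; rewrite !row_mx_coord.
    by case: fintype.split => // i; rewrite subrr normr0.
  by rewrite mulrA ler_pdivrMr// mulrC ler_pM2l// lerDl.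
rewrite leNgt; apply/negP => Mt; move: It; apply/negP; rewrite negbK -normr_le0.
apply: le_trans (Ib M _ 0 M0 (Cc_slice t fc) _) _; last by rewrite mulr0.
by move=> y; rewrite (slice_out fc Mt) normr0.
Qed.

(** The two properties have to be proved together: in dimension m they make the
    inner integral continuous, hence integrable, in dimension m + 1. *)
Lemma integral_bound_linear m : integral_bound m /\ integral_linear m.
Proof.
elim: m => [|m [Ib Il]].
  by split=> [M f B _ _ fB|//]; rewrite expr0 mul1r; exact: fB.
split.
  move=> M f B M0 fc fB; rewrite iter_integralS exprS -mulrA.
  apply: Cc1_integral_le => //; first exact: Cc1_slices.
  move=> t; apply: (Ib M) => //; first exact: Cc_slice.
  by move=> y; exact: fB.
move=> M f g a M0 fc gc; rewrite !iter_integralS.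
have iF := Cc1_integrable (Cc1_slices Ib Il M0 fc).
have iG := Cc1_integrable (Cc1_slices Ib Il M0 gc).
rewrite -RintegralZl//.
rewrite -RintegralD//; last first.
  rewrite (_ : _ \o _ = (fun t => a%:E * (EFin \o (fun t => iter_integral (slice g t))) t)%E)//.
  exact: integrableZl.
by apply: eq_Rintegral => t _; exact: (Il M _ _ _ M0 (Cc_slice t fc) (Cc_slice t gc)).
Qed.

Lemma iter_integral_ge0 m (f : 'rV[R]_m -> R) : (forall x, 0 <= f x) ->
  0 <= iter_integral f.
Proof.
elim: m f => [|m ih] f f0; first exact: f0.
by rewrite iter_integralS; apply: Rintegral_ge0 => t _; apply: ih => y; exact: f0.
Qed.

Lemma iter_integral_gt0 m M (f : 'rV[R]_m -> R) (x : 'rV[R]_m) : 0 <= M -> Cc M f ->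
  (forall x, 0 <= f x) -> 0 < f x -> 0 < iter_integral f.
Proof.
elim: m f x => [|m ih] f x M0 fc f0 fx.
  by rewrite /= (_ : 0 = x)//; apply/rowP => -[].
have [Ib Il] := integral_bound_linear m.
rewrite iter_integralS.
apply: (Cc1_integral_gt0 (t0 := (x : 'rV[R]_(1 + m)) 0 0) (Cc1_slices Ib Il M0 fc)).
  by move=> t; apply: iter_integral_ge0 => y; exact: f0.
apply: (ih _ (rsubmx (x : 'rV[R]_(1 + m)))) => //; first exact: Cc_slice.
  by move=> y; exact: f0.
by rewrite /slice -row_mx_eta.
Qed.

End IteratedIntegral.

(** * Smooth representatives: uniqueness and gluing *)

Section SmoothRepresentatives.
Context {R : realType} {n : nat}.
Local Notation V := 'rV[R]_n.
Implicit Types (g h phi psi : V -> Cplx R) (Om U K : set V) (x y : V) (u v w : functional R n).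

(** Heine's theorem; the support lies in K, so only points near K matter. *)
Lemma uniformly_continuous (f : V -> R) K (e : R) : compact K -> closed K ->
  (forall x, {for x, continuous f}) -> (forall x, f x != 0 -> K x) -> 0 < e ->
  exists2 d : R, 0 < d &
    forall x y, (forall j, `|x 0 j - y 0 j| < d) -> `|f x - f y| <= e.
Proof.
move=> Kc Kcl fc fK e0.
pose P (d : R) x := forall y, (forall j, `|x 0 j - y 0 j| < d) -> `|f x - f y| <= e.
suff [d d0 KP] : exists2 d : R, 0 < d & K `<=` P d.
  exists d => // x y xy.
  have [/KP|Kx] := pselect (K x); first exact.
  have [/KP|Ky] := pselect (K y).
    by rewrite distrC; apply=> j; rewrite distrC.
  have f0 z : ~ K z -> f z = 0 by move=> Kz; apply/eqP/negPn/negP => /fK.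
  by rewrite !f0// subrr normr0 ltW.
have : \forall d \near (0 : R)^'+, K `<=` P d.
  move/compact_near_coveringP : Kc; apply => x Kx.
  have e20 : 0 < e / 2 by rewrite divr_gt0.
  have /cvgrPdist_lt /(_ _ e20) /nbhs_box[r r0 rf] := fc x.
  have r20 : 0 < r / 2 by rewrite divr_gt0.
  exists ([set y : V | forall j, `|y 0 j - x 0 j| <= r / 2], [set d : R | d < r / 2]).
    split=> /=; last exact: nbhs_right_lt.
    apply/nbhs_ballP; exists (r / 2) => //= y [_ yx] j.
    by rewrite distrC ltW//; exact: (yx 0 j).
  move=> [y d] /= [yx dr] z yz.
  have fy : `|f x - f y| < e / 2.
    by apply: rf => j /=; apply: le_trans (yx j) _; lra.
  have fz : `|f x - f z| < e / 2.
    apply: rf => j /=; rewrite -(subrK (y 0 j) (z 0 j)) -addrA.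
    apply: le_trans (ler_normD _ _) _; rewrite distrC.
    have := yz j; have := yx j; lra.
  rewrite -(subrK (f x) (f y)) -addrA; apply: le_trans (ler_normD _ _) _.
  by rewrite distrC; lra.
move=> KP; near (0 : R)^'+ => d; exists d; first by near: d; exact: nbhs_right_gt.
by near: d; exact: KP.
Unshelve. all: by end_near.
Qed.

Lemma Cc_weak m (M M' : R) (f : 'rV[R]_m -> R) : M <= M' -> Cc M f -> Cc M' f.
Proof. by move=> MM [fu fM]; split=> // x /fM xM j; exact: le_trans (xM j) MM. Qed.

Lemma compact_coord_bounded K : compact K ->
  exists2 M : R, 0 <= M & forall x, K x -> forall j, `|x 0 j| <= M.
Proof.
move=> /compact_bounded[M [_ KM]]; exists (`|M| + 1); first by rewrite addr_ge0.
move=> x Kx j; apply: le_trans (KM (`|M| + 1) _ x Kx).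
  by rewrite -[leRHS]/(mx_norm x) mx_normrE; exact: (le_bigmax _ (fun ij => `|x ij.1 ij.2|) (0, j)).
by rewrite (le_lt_trans (ler_norm M))// ltrDl.
Qed.

Lemma test_Cc phi : test setT phi -> exists2 M : R, 0 <= M &
  Cc M (fun x => Re (phi x)) /\ Cc M (fun x => Im (phi x)).
Proof.
move=> [ps pc _]; have [M M0 pM] := compact_coord_bounded pc.
have pcont x := smooth_ccontinuous ps (I : setT x).
have [Re_supp Im_supp] : (forall x, Re (phi x) != 0 -> fsupp phi x) /\
    (forall x, Im (phi x) != 0 -> fsupp phi x).
  by split=> x px; apply: contrapT => /notin_fsupp p0; move: px; rewrite p0 eqxx.
exists M => //; split; split.
- move=> e e0; apply: (uniformly_continuous pc) => //; first exact: closed_fsupp.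
  by move=> x; apply: ccontinuous_Re.
- by move=> x /Re_supp; exact: pM.
- move=> e e0; apply: (uniformly_continuous pc) => //; first exact: closed_fsupp.
  by move=> x; have [/cvg_ReIm[_]] := pcont x.
- by move=> x /Im_supp; exact: pM.
Qed.

Lemma cintegral_lin (a : R) phi psi : test setT phi -> test setT psi ->
  cintegral (fun x => phi x + Complex a 0 * psi x) =
  cintegral phi + Complex a 0 * cintegral psi.
Proof.
move=> /test_Cc[M M0 [pr pi]] /test_Cc[N N0 [qr qi]].
have ML : M <= Num.max M N by rewrite le_max lexx.
have NL : N <= Num.max M N by rewrite le_max lexx orbT.
have L0 := le_trans M0 ML.
have [_ lin] := @integral_bound_linear R n.
apply: cplx_eqP; rewrite ?ReD ?ImD ?ReM ?ImM /= mul0r ?subr0 ?addr0.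
  rewrite -(lin _ _ _ a L0 (Cc_weak ML pr) (Cc_weak NL qr)).
  by congr iter_integral; apply/funext => x; rewrite ReD ReM /= mul0r subr0.
rewrite -(lin _ _ _ a L0 (Cc_weak ML pi) (Cc_weak NL qi)).
by congr iter_integral; apply/funext => x; rewrite ImD ImM /= mul0r addr0.
Qed.

Lemma cintegralD phi psi : test setT phi -> test setT psi ->
  cintegral (fun x => phi x + psi x) = cintegral phi + cintegral psi.
Proof.
by move=> pt qt; have := cintegral_lin 1 pt qt; under eq_fun do rewrite mul1r; rewrite mul1r.
Qed.

Lemma cintegralB phi psi : test setT phi -> test setT psi ->
  cintegral (fun x => phi x - psi x) = cintegral phi - cintegral psi.
Proof.
move=> pt qt; have := cintegral_lin (- 1) pt qt.
have -> : Complex (- 1) 0 = - 1 :> Cplx R by apply: cplx_eqP; rewrite /= ?oppr0.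
by under eq_fun do rewrite mulN1r; rewrite mulN1r.
Qed.

Lemma distr_of0 g : distr_of g (fun=> 0) = 0.
Proof.
have := cintegralB (test0 setT) (test0 setT); rewrite (subrr (cintegral _)).
by rewrite (_ : (fun=> _) = fun x => g x * 0)//; apply/funext => x; rewrite mulr0 subrr.
Qed.

(** The fundamental lemma of the calculus of variations. If d = g - h does not
    vanish at x0, test against c b, where c is the conjugate of d x0 and b is a
    bump so narrow that Re (c d) > 0 on its support: the real part of the integral
    of d c b is then positive. *)
Lemma smooth_rep_unique U u g h : open U -> smooth_rep U u g -> smooth_rep U u h ->
  forall x, U x -> g x = h x.
Proof.
move=> oU [/smoothP gs ug] [/smoothP hs uh] x0 Ux0.
pose d x := g x - h x.
have ds : smooth U d by exact: smoothB.
apply/eqP; rewrite -subr_eq0; apply/negPn/negP; rewrite -/(d x0) => d0.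
pose c : Cplx R := Complex (Re (d x0)) (- Im (d x0)).
have cx0 : 0 < Re (c * d x0).
  rewrite ReM /= mulNr opprK -!expr2 lt0r addr_ge0 ?sqr_ge0// andbT.
  apply: contra d0; rewrite paddr_eq0 ?sqr_ge0// !sqrf_eq0 => /andP[/eqP r0 /eqP i0].
  by apply/eqP/cplx_eqP.
have cont : {for x0, continuous (fun x => Re (c * d x))}.
  apply: ccontinuous_Re; apply: ccontinuousM; first exact: ccontinuous_cst.
  exact: smooth_ccontinuous ds Ux0.
have nW : \forall x \near x0, U x /\ 0 < Re (c * d x).
  apply: filterI; first exact: open_nbhs_nbhs.
  exact: (cvgr_gt _ cont).
have [b [b0 bx0 bt]] := exists_bump nW.
pose phi x : Cplx R := c * Complex (b x) 0.
have bU : test U (fun x => Complex (b x) 0) by apply: test_sub bt => x [].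
have pU : test U phi by exact: testZ.
have pW x : b x != 0 -> 0 < Re (c * d x).
  move=> bx; case: bt => _ _ bW; apply: (proj2 (bW x _)).
  by apply: subset_closure => /=; apply: contra bx => /eqP[->].
have gp : test setT (fun x => g x * phi x) := testT (testM oU gs pU).
have hp : test setT (fun x => h x * phi x) := testT (testM oU hs pU).
have dp := testT (testM oU ds pU).
have I0 : cintegral (fun x => d x * phi x) = 0.
  rewrite (_ : (fun x => _) = fun x => g x * phi x - h x * phi x); last first.
    by apply/funext => x; rewrite -mulrBl.
  rewrite cintegralB//; apply/eqP; rewrite subr_eq0; apply/eqP.
  by have /testP pU' := pU; rewrite -[LHS]ug// -[RHS]uh.
have dpE x : Re (d x * phi x) = Re (c * d x) * b x.
  by rewrite mulrA [d x * c]mulrC [LHS]ReM /= mulr0 subr0.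
have [M M0 [dr _]] := test_Cc dp.
suff : 0 < iter_integral (fun x => Re (d x * phi x)).
  by move: I0 => /(congr1 (@complex.Re R)) /= ->; rewrite ltxx.
apply: (iter_integral_gt0 (x := x0) M0 dr) => [x|]; rewrite dpE; last exact: mulr_gt0.
have [->|/pW bx] := eqVneq (b x) 0; first by rewrite mulr0.
by rewrite mulr_ge0// ltW.
Qed.

Lemma smooth_rep_sub U Om u g : U `<=` Om -> smooth_rep Om u g -> smooth_rep U u g.
Proof.
move=> UO [/smoothP gs ug]; split; first by apply/smoothP; exact: smooth_sub gs.
by move=> phi /testP /(test_sub UO) /testP; exact: ug.
Qed.

Lemma open_sing_suppC u : open (~` sing_supp u).
Proof.
rewrite /sing_supp setCK {1}openE => x [U [oU Ux [g ug]]].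
by apply: filterS (open_nbhs_nbhs (conj oU Ux)) => y Uy; exists U; split=> //; exists g.
Qed.

Definition additive_on_tests u : Prop :=
  u (fun=> 0) = 0 /\ forall phi psi, test setT phi -> test setT psi ->
    u (fun x => phi x + psi x) = u phi + u psi.

(** Local representatives agree on overlaps, hence glue; the glued function
    represents u because a test function splits into pieces of small support. *)
Lemma exists_smooth_rep u : additive_on_tests u ->
  exists g, smooth_rep (~` sing_supp u) u g.
Proof.
move=> [u0 uD].
have /choice[G GP] : forall x, exists Ug : set V * (V -> Cplx R),
    (~` sing_supp u) x -> [/\ open Ug.1, Ug.1 x & smooth_rep Ug.1 u Ug.2].
  move=> x; have [|?] := pselect ((~` sing_supp u) x); last by exists (set0, fun=> 0).
  by rewrite /sing_supp setCK => -[U [oU Ux [g ug]]]; exists (U, g).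
pose g x := (G x).2 x.
have GO x : (~` sing_supp u) x -> (G x).1 `<=` ~` sing_supp u.
  move=> /GP[oU _ ug] y Uy; rewrite /sing_supp setCK.
  by exists (G x).1; split=> //; exists (G x).2.
have gE x y : (~` sing_supp u) x -> (G x).1 y -> (G x).2 y = g y.
  move=> Ox Uy; have [oU _ ux] := GP x Ox; have [oU' Uy' uy] := GP y (GO x Ox y Uy).
  apply: (@smooth_rep_unique ((G x).1 `&` (G y).1) u (G x).2 (G y).2) => //; first exact: openI.
    by apply: smooth_rep_sub ux => z [].
  by apply: smooth_rep_sub uy => z [].
have gs x : (~` sing_supp u) x -> smooth (G x).1 g.
  move=> Ox; have [oU _ [/smoothP ux _]] := GP x Ox.
  by apply: smooth_eq ux => // y; exact: gE.
have gsm : smooth (~` sing_supp u) g.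
  apply/smoothP => s x Ox; have /smoothP := gs x Ox; apply.
  by have [] := GP x Ox.
exists g; split; first exact/smoothP.
move=> phi /testP pt.
suff [] : test (~` sing_supp u) phi /\ u phi = distr_of g phi by [].
apply: (@test_ind _ _ (fun p => test (~` sing_supp u) p /\ u p = distr_of g p)
  phi _ _ _ (testT pt)).
- split; first exact: test0.
  by rewrite u0 distr_of0.
- move=> p1 p2 [t1 e1] [t2 e2]; split; first exact: testD.
  rewrite uD ?e1 ?e2; [|exact: testT t1|exact: testT t2].
  rewrite /distr_of -cintegralD.
  - by congr cintegral; apply/funext => x; rewrite mulrDr.
  - by apply: testT (testM _ gsm t1); exact: open_sing_suppC.
  - by apply: testT (testM _ gsm t2); exact: open_sing_suppC.
- have [_ _ pO] := pt; move=> x /pO Ox.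
  have [oU Ux [uxs uxe]] := GP x Ox.
  exists (G x).1; first by split.
  move=> psi qt; split; first exact: test_sub (GO x Ox) qt.
  have /testP qt' := qt.
  rewrite uxe// /distr_of; congr cintegral; apply/funext => y.
  have [Uy|Uy] := pselect ((G x).1 y); first by rewrite gE.
  suff -> : psi y = 0 by rewrite !mulr0.
  by apply: notin_fsupp; case: qt => _ _ qU /qU.
Qed.

End SmoothRepresentatives.

Arguments open_sing_suppC {R n} u.

(** * Continuity estimates for distributions *)

Section Seminorms.
Context {R : realType} {n : nat}.
Local Notation V := 'rV[R]_n.
Implicit Types (g h phi psi theta : V -> Cplx R) (Om U K : set V) (x y : V)
  (u v w : functional R n) (s : seq 'I_n) (N : nat).

Lemma test_iter_partial Om phi s : test Om phi -> test Om (iter_partial s phi).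
Proof.
move=> [ps pc pO].
have sp : fsupp (iter_partial s phi) `<=` fsupp phi.
  apply: fsupp_sub; first exact: closed_fsupp.
  move=> x /eqP px; apply: contrapT => Sx; apply: px.
  have oS : open (~` fsupp phi) by apply: closed_openC; exact: closed_fsupp.
  rewrite (@iter_partial_eq _ _ _ _ (fun=> 0) s x oS) ?iter_partial0//.
  by move=> y; exact: notin_fsupp.
split; first exact: smooth_iter_partial.
- by apply: subclosed_compact sp => //; exact: closed_fsupp.
- exact: subset_trans sp pO.
Qed.

Lemma test_bounded Om phi : test Om phi ->
  exists2 B : R, 0 <= B & forall x, modulus (phi x) <= B.
Proof.
move=> [ps pc _]; pose f x : R := `|Re (phi x)| + `|Im (phi x)|.
have fc : continuous f.
  move=> x; have [/cvg_ReIm[cr ci]] := smooth_ccontinuous ps (I : setT x).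
  exact: (cvgD (cvg_norm cr) (cvg_norm ci)).
have : compact (f @` fsupp phi).
  by apply: continuous_compact pc; exact: continuous_subspaceT.
move=> /compact_bounded[M [_ fM]]; exists (`|M| + 1); first by rewrite addr_ge0.
move=> x; have [Kx|/notin_fsupp ->] := pselect (fsupp phi x); last first.
  by rewrite modulus0 addr_ge0.
apply: le_trans (modulus_le _) _; apply: le_trans (ler_norm _) _.
apply: (fM (`|M| + 1)); first by rewrite (le_lt_trans (ler_norm M))// ltrDl.
by exists x.
Qed.

(** With h = [sup_partial phi] this is the sum on the right-hand side of the
    estimate in [is_distribution]. *)
Definition word_sum N (h : seq 'I_n -> R) : R :=
  \sum_(k < N.+1) \sum_(s : k.-tuple 'I_n) h s.

Lemma word_sum_ge0 N (h : seq 'I_n -> R) : (forall s, 0 <= h s) -> 0 <= word_sum N h.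
Proof. by move=> h0; apply: sumr_ge0 => k _; apply: sumr_ge0 => s _. Qed.

Lemma le_word_sum N (h : seq 'I_n -> R) s : (forall s, 0 <= h s) -> (size s <= N)%N ->
  h s <= word_sum N h.
Proof.
move=> h0 sN; rewrite /word_sum (bigD1 (inord (size s) : 'I_N.+1))//=.
have sE : size s = (inord (size s) : 'I_N.+1) by rewrite inordK.
have sP : size s == (inord (size s) : 'I_N.+1) by exact/eqP.
rewrite (bigD1 (Tuple sP))//= -addrA lerDl addr_ge0//; first exact: sumr_ge0.
by apply: sumr_ge0 => k _; exact: sumr_ge0.
Qed.

Lemma ler_word_sum N (h h' : seq 'I_n -> R) :
  (forall s, (size s <= N)%N -> h s <= h' s) -> word_sum N h <= word_sum N h'.
Proof.
move=> hh; apply: ler_sum => k _; apply: ler_sum => s _; apply: hh.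
by rewrite size_tuple -ltnS.
Qed.

Lemma word_sumZ N (h : seq 'I_n -> R) (a : R) :
  word_sum N (fun s => h s * a) = word_sum N h * a.
Proof. by rewrite /word_sum mulr_suml; apply: eq_bigr => k _; rewrite mulr_suml. Qed.

Definition sup_partial phi s : R := sup (range (fun x => modulus (iter_partial s phi x))).

Lemma sup_partial_ub phi s x : test setT phi ->
  modulus (iter_partial s phi x) <= sup_partial phi s.
Proof.
move=> /(test_iter_partial s)/test_bounded[B _ pB].
by apply: ub_le_sup; [exists B => _ [y _ <-]; exact: pB|exists x].
Qed.

Lemma sup_partial_le phi s (B : R) :
  (forall x, modulus (iter_partial s phi x) <= B) -> sup_partial phi s <= B.
Proof.
move=> pB; apply: ge_sup => [|_ [y _ <-]]; last exact: pB.
by exists (modulus (iter_partial s phi 0)); exists 0.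
Qed.

Lemma sup_partial_ge0 phi s : test setT phi -> 0 <= sup_partial phi s.
Proof. by move=> pt; apply: le_trans (sup_partial_ub s 0 pt); exact: modulus_ge0. Qed.

Lemma distribution_bound u K : is_distribution u -> compact K ->
  exists2 C : R, 0 <= C & exists N, forall phi (B : R), test setT phi ->
    fsupp phi `<=` K ->
    (forall s x, (size s <= N)%N -> modulus (iter_partial s phi x) <= B) ->
    modulus (u phi) <= C * B.
Proof.
move=> [_ ub] /ub[c [N cN]].
exists (`|c| * word_sum N (fun=> 1)); first by rewrite mulr_ge0// word_sum_ge0.
exists N => phi B pt pK pB.
have /testP pt' := pt.
apply: le_trans (cN phi pt' pK) _; rewrite -mulrA -word_sumZ.
apply: (@le_trans _ _ (`|c| * word_sum N (sup_partial phi))).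
  apply: ler_wpM2r; last exact: ler_norm.
  by apply: (@word_sum_ge0 N (sup_partial phi)) => s; exact: sup_partial_ge0.
rewrite ler_wpM2l//; apply: ler_word_sum => s sN; rewrite mul1r.
by apply: sup_partial_le => x; exact: pB.
Qed.

(** By Leibniz' formula, multiplication by a test function is continuous for
    the seminorms. *)
Lemma leibniz_bound theta N : test setT theta ->
  exists2 C : R, 0 <= C & forall phi s x, test setT phi -> (size s <= N)%N ->
    modulus (iter_partial s (fun y => theta y * phi y) x) <=
    C * word_sum N (sup_partial phi).
Proof.
move=> tt; pose b s : R := \sum_(p <- splits s) sup_partial theta p.1.
have b0 s : 0 <= b s by apply: sumr_ge0 => p _; exact: sup_partial_ge0.
exists (word_sum N b); first exact: word_sum_ge0.
move=> phi s x pt sN.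
rewrite (@iter_partialM _ _ setT) //; [|exact: openT|exact: test_smooth tt|exact: test_smooth pt].
apply: le_trans (modulus_sum _ _) _.
apply: (@le_trans _ _ (b s * word_sum N (sup_partial phi))); last first.
  rewrite ler_wpM2r ?le_word_sum//; apply: word_sum_ge0 => t; exact: sup_partial_ge0.
rewrite mulr_suml !big_seq; apply: ler_sum => p ps; rewrite modulusM.
apply: ler_pM; rewrite ?modulus_ge0//; first exact: sup_partial_ub.
apply: le_trans (sup_partial_ub _ _ pt) _.
apply: le_word_sum => [t|]; first exact: sup_partial_ge0.
exact: leq_trans (size_splits ps) sN.
Qed.

Lemma distribution_mul_bound v theta K : is_distribution v -> test setT theta -> compact K ->
  exists (C : R) N, 0 <= C /\ forall phi, test setT phi -> fsupp phi `<=` K ->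
    modulus (v (fun x => theta x * phi x)) <= C * word_sum N (sup_partial phi).
Proof.
move=> vd tt Kc; have [C C0 [N vN]] := distribution_bound vd Kc.
have [D D0 tD] := leibniz_bound N tt.
exists (C * D), N; split=> [|phi pt pK]; first exact: mulr_ge0.
rewrite -mulrA; apply: vN; first exact: testMtest tt pt.
  exact: subset_trans (@fsuppMr _ _ _ _) pK.
by move=> s x sN; exact: tD.
Qed.

Lemma distribution_lin u (a : Cplx R) phi psi : is_distribution u ->
  test setT phi -> test setT psi ->
  u (fun x => a * phi x + psi x) = a * u phi + u psi.
Proof. by move=> [ul _] /testP pt /testP qt; exact: ul. Qed.

Lemma distribution0 u : is_distribution u -> u (fun=> 0) = 0.
Proof.
move=> ud; have := distribution_lin 1 ud (test0 setT) (test0 setT).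
rewrite (_ : (fun=> _) = fun=> 0); last by apply/funext => x; rewrite mulr0 addr0.
by rewrite mul1r -[X in X = _]addr0 => /addrI.
Qed.

Lemma distributionD u phi psi : is_distribution u -> test setT phi -> test setT psi ->
  u (fun x => phi x + psi x) = u phi + u psi.
Proof.
move=> ud pt qt; have := distribution_lin 1 ud pt qt; rewrite mul1r => <-.
by congr u; apply/funext => x; rewrite mul1r.
Qed.

Lemma distributionB u phi psi : is_distribution u -> test setT phi -> test setT psi ->
  u (fun x => phi x - psi x) = u phi - u psi.
Proof.
move=> ud pt qt; have := distribution_lin (-1) ud qt pt.
rewrite mulN1r addrC => <-.
by congr u; apply/funext => x; rewrite mulN1r addrC.
Qed.

Lemma distribution_additive u : is_distribution u -> additive_on_tests u.
Proof. by move=> ud; split; [exact: distribution0|move=> *; exact: distributionD]. Qed.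

Lemma is_distribution_intro v :
  (forall (a : Cplx R) phi psi, test setT phi -> test setT psi ->
     v (fun x => a * phi x + psi x) = a * v phi + v psi) ->
  (forall K, compact K -> exists (C : R) N, forall phi, test setT phi ->
     fsupp phi `<=` K -> modulus (v phi) <= C * word_sum N (sup_partial phi)) ->
  is_distribution v.
Proof.
move=> vl vb; split=> [a phi psi /testP pt /testP qt|K /vb[C [N vN]]]; first exact: vl.
by exists C, N => phi /testP pt pK; exact: vN.
Qed.

Lemma cutoff_mul theta phi K : one_around K theta -> fsupp phi `<=` K ->
  (fun x => theta x * phi x) = phi.
Proof.
move=> tK pK; apply/funext => x; have [/pK/tK/nbhs_singleton ->|/notin_fsupp ->] := pselect (fsupp phi x).
  by rewrite mul1r.
by rewrite mulr0.
Qed.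

(** A cut-off theta equal to 1 around K replaces a by the test function a theta,
    whose derivatives are bounded. *)
Lemma is_distribution_smul a v : smooth setT a -> is_distribution v ->
  is_distribution (smul a v).
Proof.
move=> sa vd; apply: is_distribution_intro => [c phi psi pt qt|K Kc].
  have := distribution_lin c vd (testM openT sa pt) (testM openT sa qt).
  rewrite /smul => <-; congr v; apply/funext => x; ring.
have [theta tt tK] := exists_cutoff Kc openT (@subsetT _ _).
have [C [N [_ vN]]] := distribution_mul_bound vd (testM openT sa tt) Kc.
exists C, N => phi pt pK; have := vN phi pt pK; rewrite /smul.
rewrite (_ : (fun x => a x * theta x * phi x) = fun x => a x * phi x)//.
rewrite -[in RHS](cutoff_mul tK pK); apply/funext => x; exact: esym (mulrA _ _ _).
Qed.

Lemma distribution_cvg0 u K (psi : nat -> V -> Cplx R) : is_distribution u -> compact K ->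
  (forall nu, test setT (psi nu)) -> (forall nu, fsupp (psi nu) `<=` K) ->
  (forall s (e : R), 0 < e ->
     \forall nu \near \oo, forall x, modulus (iter_partial s (psi nu) x) <= e) ->
  (fun nu => u (psi nu)) @ \oo --> (0 : Cplx R).
Proof.
move=> ud Kc pt pK p0; have [C C0 [N uN]] := distribution_bound ud Kc.
apply/cvg_modulusP => e e0.
have C1 : 0 < C + 1 by rewrite ltr_wpDl.
have d0 : 0 < e / (C + 1) by rewrite divr_gt0.
have : \forall nu \near \oo, forall (k : 'I_N.+1) (s : k.-tuple 'I_n) x,
    modulus (iter_partial s (psi nu) x) <= e / (C + 1).
  by apply: filter_forall => k; apply: filter_forall => s; exact: p0.
apply: filterS => nu pnu; rewrite subr0.
apply: (@le_lt_trans _ _ (C * (e / (C + 1)))).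
  apply: uN => // s x sN.
  have sE : size s = (inord (size s) : 'I_N.+1) by rewrite inordK.
  have sP : size s == (inord (size s) : 'I_N.+1) by exact/eqP.
  exact: (pnu _ (Tuple sP)).
by rewrite mulrA ltr_pdivrMr// mulrC ltr_pM2l// ltrDl.
Qed.

Lemma uniform_cvgP K (G : nat -> V -> Cplx R) g (e : R) :
  {uniform K, G @ \oo --> g} -> 0 < e ->
  \forall nu \near \oo, forall x, K x -> modulus (G nu x - g x) < e.
Proof.
move=> Gg e0.
have E0 : 0 < Complex e 0 :> Cplx R by rewrite ltcE /= eqxx.
have : nbhs (g : {uniform` K -> Cplx R}) [set h : {uniform` K -> Cplx R} |
    forall x, K x -> modulus (h x - g x) < e].
  apply/uniform_nbhs; exists [set xy | ball xy.1 (Complex e 0 : Cplx R) xy.2].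
  split; first exact: (@entourage_ball _ (Cplx R) (PosNum E0)).
  move=> h hb x Kx; have := hb x Kx.
  by rewrite /ball /= ltc_norm -opprB modulusN.
by move=> /Gg.
Qed.

(** By Leibniz' formula the derivatives of (f^nu - g) phi tend to 0 uniformly,
    since those of f^nu - g do so on the support of phi. *)
Lemma cvg_smooth_mul u Om (fs : nat -> V -> Cplx R) g phi :
  is_distribution u -> open Om -> (forall nu, smooth setT (fs nu)) -> smooth Om g ->
  (forall s K, compact K -> K `<=` Om ->
     {uniform K, (fun nu => iter_partial s (fs nu)) @ \oo --> iter_partial s g}) ->
  test Om phi ->
  (fun nu => u (fun x => fs nu x * phi x)) @ \oo --> u (fun x => g x * phi x).
Proof.
move=> ud oO fss gs fsg pt; have [ps pc pO] := pt.
have fsO nu : smooth Om (fs nu) by exact: smooth_sub (fss nu).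
pose psi nu x := (fs nu x - g x) * phi x.
have dO nu : smooth Om (fun x => fs nu x - g x) by exact: smoothB.
have psit nu : test setT (psi nu) by apply: testT; exact: testM (dO nu) pt.
have psiK nu : fsupp (psi nu) `<=` fsupp phi by exact: fsuppMr.
suff psi0 : (fun nu => u (psi nu)) @ \oo --> (0 : Cplx R).
  rewrite (_ : (fun nu => _) = fun nu => u (psi nu) + u (fun x => g x * phi x)); last first.
    apply/funext => nu; rewrite -distributionD//; last exact: testT (testM oO gs pt).
    by congr u; apply/funext => x; rewrite /psi -mulrDl subrK.
  rewrite -[X in _ --> X]add0r.
  exact: (cvgD psi0 (cvg_cst _)).
apply: (distribution_cvg0 ud pc psit psiK) => s e e0.
have key (l : seq (seq 'I_n * seq 'I_n)) (d : R) : 0 < d ->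
    \forall nu \near \oo, forall x, fsupp phi x ->
      \sum_(p <- l) modulus (iter_partial p.1 (fs nu) x - iter_partial p.1 g x) *
        sup_partial phi p.2 <= d.
  elim: l d => [|p l ih] d d0.
    by near=> nu => x _; rewrite big_nil ltW.
  have d20 : 0 < d / 2 by rewrite divr_gt0.
  have S1 : 0 < sup_partial phi p.2 + 1 by rewrite ltr_wpDl// sup_partial_ge0//; exact: testT pt.
  have := uniform_cvgP (fsg p.1 _ pc pO) (divr_gt0 d20 S1).
  apply: filterS2 (ih _ d20) => nu ihnu pnu x Kx; rewrite big_cons [d]splitr.
  apply: lerD; last exact: ihnu.
  apply: (@le_trans _ _ (d / 2 / (sup_partial phi p.2 + 1) * (sup_partial phi p.2 + 1))).
    apply: ler_pM; [exact: modulus_ge0|exact: sup_partial_ge0 (testT pt)| |].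
      by apply: ltW; exact: pnu.
    by rewrite lerDl.
  by rewrite divfK// gt_eqF.
apply: filterS (key (splits s) e e0) => nu knu x.
have [Kx|Kx] := pselect (fsupp phi x); last first.
  suff -> : iter_partial s (psi nu) x = 0 by rewrite modulus0 ltW.
  have [_ _ sK] := test_iter_partial s (test_fsupp (psiK nu) (psit nu)).
  by apply: notin_fsupp => /sK.
apply: le_trans (knu x Kx).
have Ox := pO x Kx.
rewrite (iter_partialM s oO (dO nu) (test_smooth Om pt) Ox).
apply: le_trans (modulus_sum _ _) _; apply: ler_sum => p _.
rewrite modulusM (iter_partialB p.1 oO (fsO nu) gs Ox).
by rewrite ler_wpM2l ?modulus_ge0// sup_partial_ub//; exact: testT pt.
Unshelve. all: by end_near.
Qed.

End Seminorms.

(** * The product of distributions as a limit *)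

Section Products.
Context {R : realType} {n : nat}.
Local Notation V := 'rV[R]_n.
Implicit Types (g h a phi psi theta chi : V -> Cplx R) (Om U A K : set V) (x y : V)
  (u v w f : functional R n).

Lemma cvgC_unique (G : nat -> Cplx R) (l l' : Cplx R) :
  G @ \oo --> l -> G @ \oo --> l' -> l = l'.
Proof. by move=> Gl Gl'; apply: (cvg_unique _ Gl Gl'); exact: norm_hausdorff. Qed.

Lemma test_mul_eq U g h phi : test U phi -> (forall x, U x -> g x = h x) ->
  (fun x => g x * phi x) = (fun x => h x * phi x).
Proof.
move=> [_ _ pU] gh; apply/funext => x.
by have [/pU/gh ->//|/notin_fsupp ->] := pselect (fsupp phi x); rewrite !mulr0.
Qed.

Lemma open_nbhs_sing_suppC u f x : sing_supp u `&` sing_supp f = set0 ->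
  open_nbhs x (~` sing_supp u) \/ open_nbhs x (~` sing_supp f).
Proof.
move=> disj; have [ux|ux] := pselect (sing_supp u x); [right|left].
  split; first exact: open_sing_suppC.
  by move=> fx; have : set0 x by rewrite -disj.
by split; first exact: open_sing_suppC.
Qed.

(** Around every point one of the two distributions is smooth, and both candidates
    are there given by the same formula. *)
Lemma is_dprod_unique f u w w' : sing_supp u `&` sing_supp f = set0 ->
  is_dprod f u w -> is_dprod f u w' -> forall phi, test setT phi -> w phi = w' phi.
Proof.
move=> disj [wd [g gu wg] [h hf wh]] [wd' [g' gu' wg'] [h' hf' wh']] phi pt.
apply: (@test_ind _ _ (fun p => test setT p /\ w p = w' p) phi _ _ _ pt).2.
- by split; [exact: test0|rewrite !distribution0].
- move=> p1 p2 [t1 e1] [t2 e2]; split; first exact: testD.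
  by rewrite !distributionD// e1 e2.
move=> x _; have [Ux|Ux] := open_nbhs_sing_suppC x disj.
- exists (~` sing_supp u) => // psi qt; split; first exact: testT qt.
  have /testP qt' := qt; rewrite wg// wg'//; congr f.
  by apply: test_mul_eq qt _; apply: smooth_rep_unique gu gu'; case: Ux.
- exists (~` sing_supp f) => // psi qt; split; first exact: testT qt.
  have /testP qt' := qt; rewrite wh// wh'//; congr u.
  by apply: test_mul_eq qt _; apply: smooth_rep_unique hf hf'; case: Ux.
Qed.

Lemma is_dprod_dprod f u w : is_dprod f u w -> is_dprod f u (dprod f u).
Proof. by move=> fuw; apply: (@xgetPex _ _ [set w | is_dprod f u w]); exists w. Qed.

Lemma sing_supp_distr_of a : smooth setT a -> sing_supp (distr_of a) = set0.
Proof.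
move=> sa; rewrite /sing_supp -setCT; congr setC; apply/seteqP; split=> // x _.
exists setT; split=> //; first exact: openT.
by exists a; split=> //; exact/smoothP.
Qed.

Lemma is_dprod_smul a v : smooth setT a -> is_distribution v ->
  is_dprod (distr_of a) v (smul a v).
Proof.
move=> sa vd; split; first exact: is_distribution_smul.
  have [g gv] := exists_smooth_rep (distribution_additive vd).
  exists g => // phi pt; have [/smoothP gs vg] := gv.
  have /testP pt' := pt.
  have /testP at' : test (~` sing_supp v) (fun x => a x * phi x).
    apply: testM pt'; first exact: open_sing_suppC.
    exact: smooth_sub sa.
  rewrite /smul vg// /distr_of; congr cintegral; apply/funext => x.
  by rewrite mulrCA.
exists a => //; split=> //; apply/smoothP; exact: smooth_sub sa.
Qed.

Lemma dprod_smooth a v phi : smooth setT a -> is_distribution v -> test setT phi ->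
  dprod (distr_of a) v phi = smul a v phi.
Proof.
move=> sa vd; have D := is_dprod_smul sa vd.
apply: (is_dprod_unique _ (is_dprod_dprod D) D).
by rewrite sing_supp_distr_of// setI0.
Qed.

Section Approximation.
Context (u f : functional R n) (fs : nat -> V -> Cplx R) (F : set V).
Context (hu : is_distribution u) (hf : is_distribution f)
  (hfs : forall nu, smooth setT (fs nu))
  (hcvg : cvg_distr (fun nu => distr_of (fs nu)) f)
  (hcvgF : cvg_smooth (~` F) fs f)
  (oF : open (~` F)) (fF : sing_supp f `<=` F) (uF : F `<=` ~` sing_supp u).

(** Taking the limit itself as the product makes its linearity automatic and
    spares the choice of a global partition of unity. *)
Let w phi : Cplx R := lim ((fun nu => u (fun x => fs nu x * phi x)) @ \oo).

(** Where u is a smooth function g, the action of f^nu u on phi is that of f^nu on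
    g phi, so convergence in the sense of distributions is enough. *)
Let cvg_near_sing_supp_f g phi : smooth_rep (~` sing_supp u) u g ->
  test (~` sing_supp u) phi ->
  (fun nu => u (fun x => fs nu x * phi x)) @ \oo --> f (fun x => g x * phi x).
Proof.
move=> [/smoothP gs ug] pt.
have gp := testT (testM (open_sing_suppC u) gs pt).
rewrite (_ : (fun nu => _) = fun nu => distr_of (fs nu) (fun x => g x * phi x)).
  by apply: hcvg; exact/testP.
apply/funext => nu; rewrite ug.
  by rewrite /distr_of; congr cintegral; apply/funext => x; rewrite mulrCA.
apply/testP; apply: testM pt; first exact: open_sing_suppC.
by apply: smooth_sub (hfs nu).
Qed.

Let cvg_off_F g phi : smooth_rep (~` F) f g -> test (~` F) phi ->
  (fun nu => u (fun x => fs nu x * phi x)) @ \oo --> u (fun x => g x * phi x).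
Proof.
move=> fg pt; have [g0 fg0 fsg0] := hcvgF.
rewrite (test_mul_eq pt (smooth_rep_unique oF fg fg0)).
have [/smoothP g0s _] := fg0.
exact: (cvg_smooth_mul hu oF hfs g0s fsg0 pt).
Qed.

Let cover x : open_nbhs x (~` sing_supp u) \/ open_nbhs x (~` F).
Proof.
have [Fx|Fx] := pselect (F x); [left|by right].
by split; [exact: open_sing_suppC|exact: uF].
Qed.

Let cvg_w phi : test setT phi ->
  (fun nu => u (fun x => fs nu x * phi x)) @ \oo --> w phi.
Proof.
have [g ug] := exists_smooth_rep (distribution_additive hu).
have [g0 fg0 _] := hcvgF.
have limw psi (l : Cplx R) : (fun nu => u (fun x => fs nu x * psi x)) @ \oo --> l ->
    (fun nu => u (fun x => fs nu x * psi x)) @ \oo --> w psi.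
  move=> ul; rewrite /w (cvg_lim _ ul)//; exact: norm_hausdorff.
move=> pt.
apply: (@test_ind _ _ (fun p => test setT p /\
  (fun nu => u (fun x => fs nu x * p x)) @ \oo --> w p) phi _ _ _ pt).2.
- split; first exact: test0.
  apply: (limw _ (0 : Cplx R)); rewrite (_ : (fun nu => _) = fun=> 0); first exact: cvg_cst.
  apply/funext => nu; rewrite -[RHS](distribution0 hu); congr u.
  by apply/funext => x; rewrite mulr0.
- move=> p1 p2 [t1 c1] [t2 c2]; split; first exact: testD.
  apply: (limw _ (w p1 + w p2)).
  rewrite (_ : (fun nu => _) = fun nu => u (fun x => fs nu x * p1 x) + u (fun x => fs nu x * p2 x)).
    exact: (cvgD c1 c2).
  apply/funext => nu; rewrite -distributionD//; [|exact: testM openT (hfs nu) _..].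
  by congr u; apply/funext => x; rewrite mulrDr.
move=> x _; have [Ux|Ux] := cover x.
- exists (~` sing_supp u) => // psi qt; split; first exact: testT qt.
  by apply: (limw _ _ (cvg_near_sing_supp_f ug qt)).
- exists (~` F) => // psi qt; split; first exact: testT qt.
  by apply: (limw _ _ (cvg_off_F fg0 qt)).
Qed.

Let w_eq phi l : test setT phi ->
  (fun nu => u (fun x => fs nu x * phi x)) @ \oo --> l -> w phi = l.
Proof. by move=> /cvg_w; exact: cvgC_unique. Qed.

Let w_lin (a : Cplx R) phi psi : test setT phi -> test setT psi ->
  w (fun x => a * phi x + psi x) = a * w phi + w psi.
Proof.
move=> pt qt; apply: w_eq; first by apply: testD => //; exact: testZ.
rewrite (_ : (fun nu => _) = fun nu => a * u (fun x => fs nu x * phi x) + u (fun x => fs nu x * psi x)).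
  exact: (cvgD (cvgM (cvg_cst a) (cvg_w pt)) (cvg_w qt)).
apply/funext => nu; rewrite -distribution_lin//; [|exact: testM openT (hfs nu) _..].
by congr u; apply/funext => x; rewrite mulrDr mulrCA.
Qed.

(** Having a continuity estimate for phi -> w (theta phi) is stable under sums of
    theta, so by [test_ind] it suffices to treat theta supported where w is known
    explicitly; a cut-off theta then gives the estimate for w. *)
Let w_distribution : is_distribution w.
Proof.
apply: is_distribution_intro => // K Kc.
have [theta tt tK] := exists_cutoff Kc openT (@subsetT _ _).
have [g ug] := exists_smooth_rep (distribution_additive hu).
have [g0 fg0 _] := hcvgF.
suff [_ [C [N [_ wN]]]] : test setT theta /\ exists (C : R) N, 0 <= C /\ forall phi, test setT phi ->
    fsupp phi `<=` K ->
    modulus (w (fun x => theta x * phi x)) <= C * word_sum N (sup_partial phi).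
  by exists C, N => phi pt pK; rewrite -[in leLHS](cutoff_mul tK pK); exact: wN.
apply: (@test_ind _ _ (fun p => test setT p /\ exists (C : R) N, 0 <= C /\
  forall phi, test setT phi -> fsupp phi `<=` K ->
    modulus (w (fun x => p x * phi x)) <= C * word_sum N (sup_partial phi)) theta _ _ _ tt).
- split; first exact: test0.
  exists 0, 0%N; split=> // phi _ _; rewrite mul0r.
  rewrite (_ : (fun x => _) = fun=> 0); last by apply/funext => x; rewrite mul0r.
  have := w_lin 1 (test0 setT) (test0 setT).
  rewrite (_ : (fun=> _) = fun=> 0); last by apply/funext => x; rewrite mulr0 addr0.
  by rewrite mul1r -[X in X = _]addr0 => /addrI <-; rewrite modulus0.
- move=> p1 p2 [t1 [C1 [N1 [C10 b1]]]] [t2 [C2 [N2 [C20 b2]]]]; split; first exact: testD.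
  exists (C1 + C2), (maxn N1 N2); split=> [|phi pt pK]; first exact: addr_ge0.
  have mono N N' : (N <= N')%N -> word_sum N (sup_partial phi) <= word_sum N' (sup_partial phi).
    move=> NN; rewrite /word_sum.
    rewrite (big_ord_widen N'.+1 (fun k => \sum_(s : k.-tuple 'I_n) sup_partial phi s))//.
    rewrite [leRHS](bigID (fun k : 'I_N'.+1 => (k < N.+1)%N))/= lerDl.
    by apply: sumr_ge0 => k _; apply: sumr_ge0 => s _; exact: sup_partial_ge0.
  have := w_lin 1 (testM openT (test_smooth _ t1) pt) (testM openT (test_smooth _ t2) pt).
  rewrite (_ : (fun x => _) = fun x => (p1 x + p2 x) * phi x); last first.
    by apply/funext => x; rewrite mul1r mulrDl.
  rewrite mul1r => ->; apply: le_trans (modulusD _ _) _; rewrite mulrDl.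
  apply: lerD.
    apply: le_trans (b1 _ pt pK) _; rewrite ler_wpM2l//; apply: mono; exact: leq_maxl.
  apply: le_trans (b2 _ pt pK) _; rewrite ler_wpM2l//; apply: mono; exact: leq_maxr.
move=> x _; have [Ux|Ux] := cover x.
- exists (~` sing_supp u) => // p qt; split; first exact: testT qt.
  have [/smoothP gs _] := ug.
  have gp := testT (testM (open_sing_suppC u) gs qt).
  have [C [N [C0 bN]]] := distribution_mul_bound hf gp Kc.
  exists C, N; split=> // phi pt pK.
  have qp := testMtest qt pt.
  rewrite (w_eq (testT qp) (cvg_near_sing_supp_f ug qp)).
  rewrite (_ : (fun x => _) = fun x => g x * p x * phi x); first exact: bN.
  by apply/funext => y; rewrite mulrA.
- exists (~` F) => // p qt; split; first exact: testT qt.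
  have [/smoothP gs _] := fg0.
  have gp := testT (testM oF gs qt).
  have [C [N [C0 bN]]] := distribution_mul_bound hu gp Kc.
  exists C, N; split=> // phi pt pK.
  have qp := testMtest qt pt.
  rewrite (w_eq (testT qp) (cvg_off_F fg0 qp)).
  rewrite (_ : (fun x => _) = fun x => g0 x * p x * phi x); first exact: bN.
  by apply/funext => y; rewrite mulrA.
Qed.

(** The complement of F may be smaller than that of the singular support of f, so
    the formula w = h u has to be localized further: off F it comes from the smooth
    convergence, and at points of F the distribution u is itself smooth. *)
Lemma is_dprod_lim : is_dprod f u w.
Proof.
have [g ug] := exists_smooth_rep (distribution_additive hu).
have [h fh] := exists_smooth_rep (distribution_additive hf).
have [/smoothP gs ugE] := ug; have [/smoothP hs fhE] := fh.
split; first exact: w_distribution.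
  exists g => // phi /testP pt; exact: w_eq (testT pt) (cvg_near_sing_supp_f ug pt).
exists h => // phi /testP pt.
have hM psi : test (~` sing_supp f) psi -> test setT (fun x => h x * psi x).
  by move=> qt; apply: testT; apply: testM qt => //; exact: open_sing_suppC.
apply: (@test_ind _ _ (fun p => test (~` sing_supp f) p /\ w p = smul h u p) phi _ _ _ (testT pt)).2.
- split; first exact: test0.
  rewrite (distribution0 w_distribution) /smul -[LHS](distribution0 hu); congr u.
  by apply/funext => x; rewrite mulr0.
- move=> p1 p2 [t1 e1] [t2 e2]; split; first exact: testD.
  rewrite (distributionD w_distribution (testT t1) (testT t2)) e1 e2 /smul.
  rewrite -(distributionD hu (hM _ t1) (hM _ t2)).
  by congr u; apply/funext => x; rewrite mulrDr.
have [_ _ pO] := pt; move=> x /pO Ox; have [Ux|Ux] := cover x.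
- exists (~` sing_supp u `&` ~` sing_supp f).
    by apply: open_nbhsI => //; split => //; exact: open_sing_suppC.
  move=> psi qt.
  have qu : test (~` sing_supp u) psi by apply: test_sub qt => y [].
  have qf : test (~` sing_supp f) psi by apply: test_sub qt => y [].
  split=> //; rewrite (w_eq (testT qu) (cvg_near_sing_supp_f ug qu)).
  (* On the common domain both sides are the integral of g h psi. *)
  rewrite fhE; last first.
    apply/testP; apply: test_fsupp (testM (open_sing_suppC u) gs qu).
    by case: qf => _ _; exact: subset_trans (@fsuppMr _ _ _ _).
  rewrite /smul ugE; last first.
    apply/testP; apply: test_fsupp (hM _ qf).
    by case: qu => _ _; exact: subset_trans (@fsuppMr _ _ _ _).
  by rewrite /distr_of; congr cintegral; apply/funext => y; rewrite mulrCA.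
- exists (~` F) => // psi qt; split.
    by apply: test_sub qt => y; apply: contra_not; exact: fF.
  apply: w_eq (testT qt) _.
  apply: cvg_off_F qt; apply: smooth_rep_sub fh => y; apply: contra_not; exact: fF.
Qed.

Lemma cvg_smul_dprod : sing_supp u `&` sing_supp f = set0 ->
  is_dprod f u (dprod f u) /\ cvg_distr (fun nu => smul (fs nu) u) (dprod f u).
Proof.
move=> disj; have D := is_dprod_dprod is_dprod_lim; split; first exact: D.
move=> phi /testP pt.
by rewrite (is_dprod_unique disj D is_dprod_lim pt); exact: cvg_w.
Qed.

End Approximation.

(** * Extended actions *)

(** The difference of two cut-offs vanishes near the support of w, hence splits
    into test functions on open sets where w is 0. *)
Lemma pair_eval w A phi : is_distribution w -> dsupp w `<=` A -> test setT phi ->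
  one_around A phi -> pair_one w = w phi.
Proof.
move=> wd wA pt p1; rewrite /pair_one.
set psi := xget _ _.
have [/testP qt q1] : test_on setT psi /\ one_around (dsupp w) psi.
  apply: (@xgetPex _ _ [set phi | test_on setT phi /\ one_around (dsupp w) phi]).
  by exists phi; split; [exact/testP|move=> x /wA; exact: p1].
apply/eqP; rewrite -subr_eq0 -(distributionB wd qt pt); apply/eqP.
apply: (@test_ind _ _ (fun p => test setT p /\ w p = 0) _ _ _ _ (testB qt pt)).2.
- by split; [exact: test0|exact: distribution0].
- move=> p p' [t e] [t' e']; split; first exact: testD.
  by rewrite distributionD// e e' addr0.
move=> x Dx; have : (~` dsupp w) x.
  move=> wx; move: Dx; rewrite /fsupp.
  have : \forall y \near x, psi y - phi y = 0.
    by apply: filterS2 (q1 x wx) (p1 x (wA x wx)) => y -> ->; rewrite subrr.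
  by move=> n0 /(_ _ n0)[y [/eqP +]]; apply.
rewrite /dsupp setCK => -[U [oU Ux w0]]; exists U => //.
by move=> p t; split; [exact: testT t|apply: w0; exact/testP].
Qed.

Lemma dsupp_sub u K : closed K -> (forall phi, test (~` K) phi -> u phi = 0) ->
  dsupp u `<=` K.
Proof.
move=> Kcl u0 x ux; apply: contrapT => Kx; apply: ux.
exists (~` K); split=> //; first exact: closed_openC.
by move=> phi /testP; exact: u0.
Qed.

Lemma dsupp_eq u v : (forall phi, test setT phi -> u phi = v phi) -> dsupp u = dsupp v.
Proof.
move=> uv; rewrite /dsupp; congr setC; apply/seteqP.
by split=> x [U [oU Ux u0]]; exists U; split=> // phi pt; rewrite -(u0 phi pt) ?uv//;
  move/testP : pt; exact: testT.
Qed.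

Lemma dsupp_smul_sub a v : is_distribution v -> dsupp (smul a v) `<=` fsupp a.
Proof.
move=> vd; apply: dsupp_sub; first exact: closed_fsupp.
move=> phi [_ _ pa]; rewrite /smul -[RHS](distribution0 vd); congr v.
apply/funext => x; have [ax|/notin_fsupp ->] := pselect (fsupp a x); last exact: mul0r.
rewrite (_ : phi x = 0) ?mulr0//; by apply: notin_fsupp => /pa.
Qed.

Lemma dsupp_smul_dsupp a v : smooth setT a -> dsupp (smul a v) `<=` dsupp v.
Proof.
move=> sa x; apply: contra_not => -[U [oU Ux v0]]; exists U; split=> // phi /testP pt.
by rewrite /smul v0//; apply/testP; apply: testM pt => //; exact: smooth_sub sa.
Qed.

Lemma distr_of_cst0 phi : distr_of (fun=> 0) phi = 0.
Proof.
rewrite -[RHS](@distr_of0 R n (fun=> 0)) /distr_of.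
by rewrite (_ : (fun x => 0 * phi x) = fun=> 0 * 0)//; apply/funext => x; rewrite !mul0r.
Qed.

Lemma smooth_rep_eq0 U u g : open U -> eq_distr_on U u (fun=> 0) ->
  smooth_rep (~` sing_supp u) u g -> U `<=` ~` sing_supp u /\ forall x, U x -> g x = 0.
Proof.
move=> oU u0 ug.
have r0 : smooth_rep U u (fun=> 0).
  split; first by apply/smoothP; exact: smooth_cst.
  by move=> phi pt; rewrite u0// distr_of_cst0.
have US : U `<=` ~` sing_supp u.
  by move=> x Ux; rewrite /sing_supp setCK; exists U; split=> //; exists (fun=> 0).
split=> // x Ux.
by rewrite (smooth_rep_unique oU (smooth_rep_sub US ug) r0 Ux).
Qed.

(** Where u or f vanishes, its smooth representative is 0, and so is the product. *)
Lemma dsupp_is_dprod f u w : is_distribution u -> f (fun=> 0) = 0 ->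
  is_dprod f u w -> dsupp w `<=` dsupp u `&` dsupp f.
Proof.
move=> ud f0 [wd [g ug wg] [h fh wh]] x wx.
split; apply: contrapT => Hx; apply: wx.
- have : (~` dsupp u) x by [].
  rewrite /dsupp setCK => -[U [oU Ux u0]]; exists U; split=> // phi /testP pt.
  have [US g0] := smooth_rep_eq0 oU u0 ug.
  rewrite wg; last exact/testP/(test_sub US).
  rewrite /smul (test_mul_eq pt g0) -[RHS]f0; congr f.
  by apply/funext => y; rewrite mul0r.
- have : (~` dsupp f) x by [].
  rewrite /dsupp setCK => -[U [oU Ux u0]]; exists U; split=> // phi /testP pt.
  have [US h0] := smooth_rep_eq0 oU u0 fh.
  rewrite wh; last exact/testP/(test_sub US).
  rewrite /smul (test_mul_eq pt h0) -[RHS](distribution0 ud); congr u.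
  by apply/funext => y; rewrite mul0r.
Qed.

(** A single cut-off, equal to 1 around every support involved, turns the
    extended actions into values of f^nu u at one fixed test function. *)
Lemma cvg_ext_action u f (fs : nat -> V -> Cplx R) chi K :
  is_distribution u -> is_distribution f -> (forall nu, smooth setT (fs nu)) ->
  is_dprod f u (dprod f u) -> cvg_distr (fun nu => smul (fs nu) u) (dprod f u) ->
  compact (dsupp u `&` dsupp f) -> smooth setT chi -> compact K ->
  one_around (dsupp u `&` dsupp f) chi ->
  (forall nu, dsupp (smul (fun x => chi x * fs nu x) u) `<=` K) ->
  (fun nu => ext_action (smul chi u) (distr_of (fs nu))) @ \oo --> ext_action u f /\
  (fun nu => ext_action u (distr_of (fun x => chi x * fs nu x))) @ \oo --> ext_action u f.
Proof.
move=> ud fd fss D fuc Ac chis Kc chi1 WK.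
have [phi pt p1] := exists_cutoff (compactU Kc Ac) openT (@subsetT _ _).
have cp : test setT (fun x => chi x * phi x) by exact: testM openT chis pt.
have limE : ext_action u f = dprod f u (fun x => chi x * phi x).
  have [wd _ _] := D.
  apply: (pair_eval wd (dsupp_is_dprod ud (distribution0 fd) D) cp) => x Ax.
  apply: filterS2 (chi1 x Ax) (p1 x (or_intror Ax)) => y -> ->.
  by rewrite mulr1.
have cs nu : smooth setT (fun x => chi x * fs nu x) by exact: smoothM openT chis (fss nu).
have valE v a nu : is_distribution v -> smooth setT a ->
    (forall psi, test setT psi -> smul a v psi = smul (fun x => chi x * fs nu x) u psi) ->
    ext_action v (distr_of a) = u (fun x => fs nu x * (chi x * phi x)).
  move=> vd sa vE.
  have Dv := is_dprod_dprod (is_dprod_smul sa vd); have [dd _ _] := Dv.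
  have dE psi : test setT psi ->
      dprod (distr_of a) v psi = smul (fun x => chi x * fs nu x) u psi.
    by move=> qt; rewrite dprod_smooth// vE.
  rewrite /ext_action (pair_eval (A := K) dd _ pt).
  - rewrite dE// /smul; congr u; apply/funext => x; by rewrite mulrCA mulrA.
  - by rewrite (dsupp_eq dE); exact: WK.
  - by move=> x Kx; apply: p1; left.
have cvg0 := fuc _ (proj2 (testP _ _) cp); rewrite /smul in cvg0.
rewrite limE; split.
- rewrite (_ : (fun nu => _) = fun nu => u (fun x => fs nu x * (chi x * phi x)))//.
  apply/funext => nu; apply: valE => //; first exact: is_distribution_smul.
  by move=> psi _; rewrite /smul; congr u; apply/funext => x; rewrite mulrA.
- rewrite (_ : (fun nu => _) = fun nu => u (fun x => fs nu x * (chi x * phi x)))//.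
  by apply/funext => nu; apply: valE.
Qed.

End Products.

Theorem theorem7p2 (R : realType) (n : nat) (u f : functional R n)
    (fs : nat -> 'rV[R]_n -> Cplx R) (F : set 'rV[R]_n)
    (hu : is_distribution u) (hf : is_distribution f)
    (hfs : forall nu, smooth_on setT (fs nu))
    (hcvg : cvg_distr (fun nu => distr_of (fs nu)) f)
    (hcvgF : cvg_smooth (~` F) fs f)
    (hF : F = sing_supp f \/
          [/\ closed F, sing_supp f `<=` F & F `<=` ~` sing_supp u])
    (hdisj : sing_supp u `&` sing_supp f = set0) :
  cvg_distr (fun nu => smul (fs nu) u) (dprod f u) /\
  (compact (dsupp u `&` dsupp f) ->
    forall chi : 'rV[R]_n -> Cplx R,
      (test_on setT chi /\ one_around (dsupp u `&` dsupp f) chi) \/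
      (chi = (fun=> 1) /\
       exists2 K : set 'rV[R]_n, compact K &
         dsupp u `<=` K \/ \bigcup_nu dsupp (smul (fs nu) u) `<=` K) ->
      (fun nu => ext_action (smul chi u) (distr_of (fs nu))) @ \oo
        --> ext_action u f /\
      (fun nu => ext_action u (distr_of (fun x => chi x * fs nu x))) @ \oo
        --> ext_action u f).
Proof.
have fss nu : smooth setT (fs nu) by exact/smoothP.
have [oF fF uF] : [/\ open (~` F), sing_supp f `<=` F & F `<=` ~` sing_supp u].
  case: hF => [->|[cF fF uF]]; split=> //; [exact: open_sing_suppC| |exact: closed_openC].
  by move=> x fx ux; have : set0 x by rewrite -hdisj.
have [D fuc] := cvg_smul_dprod hu hf fss hcvg hcvgF oF fF uF hdisj.
split; first exact: fuc.
move=> Ac chi [[/testP ct chi1]|[-> [K Kc uK]]].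
  have [cs cc _] := ct.
  apply: (cvg_ext_action hu hf fss D fuc Ac cs cc chi1) => nu.
  exact: subset_trans (dsupp_smul_sub hu) (@fsuppMl _ _ _ _).
have c1 : smooth [set: 'rV[R]_n] (fun=> 1 : Cplx R) by exact: smooth_cst.
apply: (cvg_ext_action hu hf fss D fuc Ac c1 Kc).
  by move=> x _; near=> y.
move=> nu; rewrite (_ : (fun x => 1 * fs nu x) = fs nu); last first.
  by apply/funext => x; rewrite mul1r.
case: uK => uK; first by apply: subset_trans uK; exact: dsupp_smul_dsupp.
by apply: subset_trans uK => x wx; exists nu.
Unshelve. all: by end_near.
Qed.
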